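(* Let $G$ be a finitely generated non-nilpotent meta-$\mathfrak{Nil}$-Hamiltonian group which has a torsion-free soluble subgroup of finite index. Then: (i) $G'$ is finite and $G$ is soluble; (ii) $G$ is center-by-finite, i.e. $|G:Z(G)|$ is finite; (iii) $G$ is polycyclic and $\mathrm{Fit}(G)$ is nilpotent of finite index in $G$; (iv) there are only finitely many maximal subgroups $M$ of $G$ with $G=MG'$, and each such $M$ is nilpotent.
   Context: A group $G$ is meta-$\mathfrak{Nil}$-Hamiltonian if every non-nilpotent subgroup of $G$ is normal in $G$. $Z(G)$ is the center and $\mathrm{Fit}(G)$ the Fitting subgroup (generated by all nilpotent normal subgroups) of $G$. *)

(* Defs.v *)
From Stdlib Require Import List ZArith.
Unset Implicit Arguments.

Record Group := {
  carrier :> Type;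
  mul : carrier -> carrier -> carrier;
  inv : carrier -> carrier;
  one : carrier;
  mulA : forall x y z, mul x (mul y z) = mul (mul x y) z;
  mul1g : forall x, mul one x = x;
  mulVg : forall x, mul (inv x) x = one
}.

Section GroupDefs.
Variable G : Group.
Local Notation "x * y" := (mul G x y).
Local Notation "x ^-1" := (inv G x) (at level 3, format "x ^-1").
Local Notation "1" := (one G).

Definition gset := G -> Prop.
Definition setT : gset := fun _ => True.
Definition subset (A B : gset) := forall x, A x -> B x.
Definition set_eq (A B : gset) := forall x, A x <-> B x.
Definition trivial_set (A : gset) := forall x, A x -> x = 1.

Definition is_subgroup (H : gset) :=
  H 1 /\ (forall x y, H x -> H y -> H (x * y)) /\ (forall x, H x -> H (x^-1)).

Definition generated (S : gset) : gset :=
  fun x => forall H, is_subgroup H -> subset S H -> H x.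

Definition normal_in (H K : gset) :=
  is_subgroup H /\ subset H K /\
  forall k h, K k -> H h -> H (k^-1 * h * k).

Definition comm (x y : G) := x^-1 * y^-1 * x * y.

Definition commsub (A B : gset) : gset :=
  generated (fun z => exists a b, A a /\ B b /\ z = comm a b).

Fixpoint lcs (H : gset) (n : nat) : gset :=
  match n with O => H | S m => commsub (lcs H m) H end.

Definition nilpotent (H : gset) := exists n, trivial_set (lcs H n).

Fixpoint derived (H : gset) (n : nat) : gset :=
  match n with O => H | S m => commsub (derived H m) (derived H m) end.

Definition soluble (H : gset) := exists n, trivial_set (derived H n).

Definition derived_subgroup : gset := commsub setT setT.

Definition center : gset := fun x => forall y, x * y = y * x.

Definition fitting : gset :=
  generated (fun x => exists N, normal_in N setT /\ nilpotent N /\ N x).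

Definition finite_set (A : gset) := exists l : list G, forall x, A x -> In x l.

Definition finite_index (H K : gset) :=
  exists l : list G, forall k, K k -> exists t, In t l /\ H (t^-1 * k).

Definition finitely_generated :=
  exists l : list G, forall x, generated (fun y => In y l) x.

Fixpoint gpow (x : G) (n : nat) : G :=
  match n with O => 1 | S m => x * gpow x m end.

Definition torsion_free (H : gset) :=
  forall x n, H x -> (0 < n)%nat -> gpow x n = 1 -> x = 1.

Definition meta_nil_hamiltonian :=
  forall H, is_subgroup H -> ~ nilpotent H -> normal_in H setT.

(* polycyclic: a finite subnormal series G = S_0 >= S_1 >= ... >= S_n = 1
   with cyclic factors S_i / S_{i+1} *)
Definition polycyclic :=
  exists (n : nat) (S : nat -> gset),
    set_eq (S O) setT /\ trivial_set (S n) /\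
    forall i, (i < n)%nat ->
      normal_in (S (Datatypes.S i)) (S i) /\
      exists x, S i x /\
        set_eq (S i) (generated (fun z => z = x \/ S (Datatypes.S i) z)).

Definition maximal_subgroup (M : gset) :=
  is_subgroup M /\ (exists g, ~ M g) /\
  forall K, is_subgroup K -> subset M K -> set_eq K M \/ set_eq K setT.

Definition product_with_derived_is_G (M : gset) :=
  forall g, exists m d, M m /\ derived_subgroup d /\ g = m * d.

End GroupDefs.

(* Main.v *)
(** Call [x] Engel on [B] if every [b] in [B] satisfies [[b, x, ..., x] = 1].

    A finite group with all non-nilpotent subgroups normal is soluble: by induction one is
    left with a simple group all of whose proper subgroups are nilpotent, where distinct
    maximal subgroups meet trivially and counting their conjugates gives a contradiction
    (Schmidt).  Applied to the action on the cosets of [H], this makes [G] soluble.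

    A finitely generated soluble group in which every element is Engel is nilpotent
    (Gruenberg), so some [x] is not Engel on [G].  Normality of the non-nilpotent subgroups
    [<B, x>], for [B] in an abelian normal subgroup [A] on which [x] is not Engel, forces the
    quotient of [Z[X, 1/X]] acting on a suitable element of [A] to be a field, hence finite.
    If every element is Engel on [A], a pair found in [G/A] is lifted with the transfer into
    [A].  Thus by induction on the derived length there is a finite subgroup [F], normalised
    by some [x] that is not Engel on it.  Now [F<x^k>] is non-nilpotent for infinitely many
    [k], so modulo these subgroups all subgroups are normal, and [G'] is finite.  The
    remaining claims follow from the finiteness of [G']. *)

(* Normality is granted to non-nilpotent subgroups only. A finite [F] with a non-Engel action of [x]
   supplies many of these: if [x^s] centralises [F], every [x^(1 + s l)] acts on [F] as [x] does, so
   any subgroup containing [F] and one of these powers is non-nilpotent, hence normal. Since 0 is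
   the only integer divisible by all [1 + s l], facts modulo each of these powers add up to facts
   modulo [F].

   The field arises as follows. For [B] generated by [f a], normality of [<B, x>] puts [[u, x, x]]
   into [[B, x]] for all [u] in [A]; in module terms, [(X - 1)^2] becomes a multiple of [(X - 1) f].
   Passing from [a] to [[a, x, x]] absorbs the powers of [X - 1].

   The transfer is chosen because it commutes with [x]. When all elements are Engel on [A], those of
   a finite extension of [A] act on [A] trivially modulo torsion, so on [A] the transfer is
   multiplication by the index modulo torsion. Its kernel thus meets [A] in torsion elements, and
   iterated commutators with [x] end up in this kernel. *)
From HB Require Import structures.
From mathcomp Require Import all_boot all_order all_algebra all_fingroup all_solvable.
From mathcomp Require Import boolp.
From Stdlib Require List.
Set Implicit Arguments. Unset Strict Implicit. Unset Printing Implicit Defensive.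

(** * Finite groups *)

Section Schmidt.
Local Open Scope group_scope.
Variable gT : finGroupType.
Variable G : {group gT}.
Implicit Types H K M N : {group gT}.

Hypothesis simpleG : forall N, N <| G -> N :=: 1 \/ N :=: G.
Hypothesis nilG : forall H, H \proper G -> nilpotent H.
Hypothesis not_nilG : ~~ nilpotent G.

(** Downward induction on the order of the intersection. A non-trivial intersection [I] has a proper
    normaliser, lying in a maximal [M3]. Normalisers grow in the nilpotent groups [M1] and [M2], so
    both meet [M3] in more than [I], which forces [M1 = M3 = M2]. *)
Lemma schmidt_maximal_cap_aux n M1 M2 : maximal M1 G -> maximal M2 G ->
  M1 :!=: M2 -> #|G| - #|M1 :&: M2| <= n -> M1 :&: M2 = 1.
Proof.
elim: n M1 M2 => [|n IH] M1 M2 max1 max2 neqM lenI; apply/eqP.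
  have := maxgroupp max1; move/(sub_proper_trans (subsetIl M1 M2))/proper_card.
  by rewrite -subn_gt0; case: (_ - _)%N lenI.
apply/negPn/negP=> ntI; set I := (M1 :&: M2)%G.
have [pM1 pM2] := (maxgroupp max1, maxgroupp max2).
have pI : I \proper G := sub_proper_trans (subsetIl M1 M2) pM1.
have : 'N_G(I) \proper G.
  rewrite properE subsetIl /=; apply/negP => sGN.
  have nIG : I <| G by rewrite /normal (proper_sub pI) (subset_trans sGN (subsetIr _ _)).
  have [I1 | IG] := simpleG nIG; first by rewrite -/(gval I) I1 eqxx in ntI.
  by rewrite properE IG subxx in pI.
move=> pN; have [eqN | [M3 max3 sN3]] := maximal_exists (proper_sub pN).
  by rewrite properE eqN subxx in pN.
have step M M' : maximal M G -> maximal M' G -> M :!=: M' -> I :=: M :&: M' -> M :=: M3.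
  move=> maxM maxM' neq defI; apply/eqP/negPn/negP=> neq3.
  have sMG := proper_sub (maxgroupp maxM).
  have pIM : I \proper M.
    rewrite properEneq defI subsetIl andbT; apply: contra neq => /eqP/setIidPl sMM'.
    by case/maxgroupP: maxM => _ /(_ M' (maxgroupp maxM') sMM') ->.
  have pNI := nilpotent_proper_norm (nilG (maxgroupp maxM)) pIM.
  have sNI : 'N_M(I) \subset M :&: M3.
    by rewrite subsetI subsetIl (subset_trans (setSI _ sMG) sN3).
  have ltI := proper_card (proper_sub_trans pNI sNI).
  have M31 : M :&: M3 = 1.
    apply: IH => //; move: lenI ltI; rewrite -/(gval I) => h1 h2.
    have := subset_leq_card (subset_trans (subsetIl M M3) sMG).
    move: h1 h2; rewrite leq_subLR [_ - _ <= _]leq_subLR.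
    by move=> h1 h2 _; apply: leq_trans h1 _; rewrite addnS -addSn leq_add2r.
  by move: ltI; rewrite M31 cards1 ltnS leqn0 cards_eq0; case/set0Pn; exists 1.
have e1 : M1 :=: M3 by apply: (step M1 M2).
have e2 : M2 :=: M3 by apply: (step M2 M1); rewrite // 1?eq_sym // setIC.
by rewrite e1 e2 eqxx in neqM.
Qed.

Lemma schmidt_maximal_cap M1 M2 : maximal M1 G -> maximal M2 G ->
  M1 :!=: M2 -> M1 :&: M2 = 1.
Proof. by move=> m1 m2 neq; apply: (schmidt_maximal_cap_aux m1 m2 neq (leqnn _)). Qed.

Lemma schmidt_cycle g : g \in G -> exists2 M : {group gT}, maximal M G & g \in M.
Proof.
rewrite -cycle_subG => sgG; have [gG | [M maxM sgM]] := maximal_exists sgG.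
  by case/negP: not_nilG; rewrite -gG abelian_nil // cycle_abelian.
by exists M; rewrite // -cycle_subG.
Qed.

Lemma schmidt_maximal_neq1 M : maximal M G -> M :!=: 1.
Proof.
move=> maxM; apply/eqP => M1.
have [G1 | ntG] := eqVneq (gval G) 1; first by case/negP: not_nilG; rewrite G1 nilpotent1.
have [g Gg ntg] := trivgPn _ ntG; have [M' maxM' gM'] := schmidt_cycle Gg.
have sMM' : M \subset M'.
  by rewrite M1 sub1G.
case/maxgroupP: maxM => _ /(_ M' (maxgroupp maxM') sMM') M'M.
by rewrite M'M M1 inE (negPf ntg) in gM'.
Qed.

Lemma schmidt_maximalJ M g : maximal M G -> g \in G -> maximal (M :^ g) G.
Proof. by move=> maxM Gg; rewrite -(conjGid Gg) maximalJ. Qed.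

Lemma schmidt_normedTI M : maximal M G -> normedTI M^# G M.
Proof.
move=> maxM; have ntM := schmidt_maximal_neq1 maxM.
have pM := maxgroupp maxM; have sMG := proper_sub pM.
apply/normedTI_P; split; rewrite ?setD_eq0 ?subG1 //.
  by rewrite subsetI sMG normD1 normG.
move=> g Gg; rewrite -setI_eq0 conjD1g -setDIl setD_eq0 subG1 => ntMg.
have eqM : M :=: M :^ g.
  apply/eqP/negPn/negP => neq; case/negP: ntMg; apply/eqP.
  exact: (@schmidt_maximal_cap M (M :^ g)%G maxM (schmidt_maximalJ maxM Gg) neq).
have : g \in 'N_G(M) by rewrite inE Gg; apply/normP.
have /maxgroupP[_ mx] := maxM.
rewrite (mx 'N_G(M)%G) //; last by rewrite subsetI sMG normG.
rewrite properE subsetIl /=; apply/negP => sGN.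
have nMG : M <| G by rewrite /normal sMG (subset_trans sGN (subsetIr _ _)).
have [M1 | MG] := simpleG nMG; first by rewrite M1 eqxx in ntM.
by rewrite properE MG subxx in pM.
Qed.

(** The [|G : M|] conjugates of [M] meet trivially, so their non-identity elements number
    [|G : M| (|M| - 1)]. The lower bound uses [|M| >= 2]; the upper one uses [|G : M| >= 2] and
    shows that some non-identity element is missed. *)
Lemma schmidt_card_support M : maximal M G ->
  (#|G| <= #|class_support M^# G|.*2) && (#|class_support M^# G|.+1 < #|G|).
Proof.
move=> maxM; have pM := maxgroupp maxM; have sMG := proper_sub pM.
have ntM := schmidt_maximal_neq1 maxM.
rewrite (card_support_normedTI (schmidt_normedTI maxM)) -(Lagrange sMG).
have : 1 < #|M| by rewrite cardG_gt1.
have : 1 < #|G : M| by rewrite indexg_gt1; case/andP: pM.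
rewrite [#|M|](cardsD1 1) group1 add1n ltnS.
move: #|M^#| #|G : M| => a b b1 a1; apply/andP; split.
  by rewrite -mul2n mulSn mulnA mulSn mul1n mulnDl leq_add2r leq_pmull.
by rewrite mulSn -addn2 addnC leq_add2r.
Qed.

(** An element missed by the conjugates of [M] lies in a maximal [M'] not conjugate to [M]. The two
    supports are disjoint and each has at least [|G| / 2] elements, one too many for the set of
    non-identity elements. *)
Lemma schmidt_absurd : False.
Proof.
have [M maxM _] := schmidt_cycle (group1 G).
have /andP[geM ltM] := schmidt_card_support maxM.
have sub_cs K : maximal K G -> class_support K^# G \subset G^#.
  move=> maxK; apply/subsetP=> _ /imset2P[k g /setD1P[ntk kK] Gg ->].
  rewrite !inE conjg_eq1 ntk groupJ // (subsetP (proper_sub (maxgroupp maxK))) //.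
have : ~~ (G^# \subset class_support M^# G).
  apply/negP=> /subset_leq_card; rewrite leqNgt; case/negP.
  by rewrite -ltnS (leq_trans ltM) // (cardsD1 1 G) group1.
case/subsetPn=> g /setD1P[ntg Gg] ncs.
have [M' maxM' gM'] := schmidt_cycle Gg.
have /andP[geM' _] := schmidt_card_support maxM'.
have dis : class_support M^# G :&: class_support M'^# G = set0.
  apply/setP=> z; rewrite !inE; apply/negP=> /andP[].
  case/imset2P=> m a /setD1P[ntm mM] Ga ->.
  case/imset2P=> m' b /setD1P[_ mM'] Gb e.
  have Gab : (b * a^-1)%g \in G by rewrite groupM ?groupV.
  have em : m = m' ^ (b * a^-1) by rewrite conjgM -e conjgK.
  have [eqM | neqM] := eqVneq (gval M) (M' :^ (b * a^-1)).
    case/negP: ncs; apply/imset2P; exists (g ^ (b * a^-1)) (b * a^-1)^-1; rewrite ?groupV ?conjgK //.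
    by rewrite !inE conjg_eq1 ntg eqM memJ_conjg.
  have := @schmidt_maximal_cap M (M' :^ (b * a^-1))%G maxM (schmidt_maximalJ maxM' Gab) neqM.
  move/setP/(_ m); rewrite !inE mM (negPf ntm) em memJ_conjg mM' //.
have : #|class_support M^# G :|: class_support M'^# G| <= #|G^#|.
  by rewrite subset_leq_card // subUset !sub_cs.
rewrite cardsU dis cards0 subn0 leqNgt; case/negP.
move: geM geM'; rewrite (cardsD1 1 G) group1 add1n.
move: #|class_support M^# G| #|class_support M'^# G| #|G^#| => p q r h1 h2.
rewrite -ltn_double doubleD -addnn; apply: leq_trans (leq_add h1 h2).
by rewrite addSn ltnS leq_add2l.
Qed.

End Schmidt.

Section FiniteMNH.
Local Open Scope group_scope.

Theorem finite_meta_nil_hamiltonian_sol (gT : finGroupType) (G : {group gT}) :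
  (forall H : {group gT}, H \subset G -> ~~ nilpotent H -> H <| G) -> solvable G.
Proof.
have [n] := ubnP #|G|; elim: n gT G => // n IH gT G leGn mnh.
have [/nilpotent_sol-> // | nnil] := boolP (nilpotent G).
have [/existsP[N /and3P[nNG ntN pN]] | simpleG] :=
  boolP [exists N : {group gT}, [&& N <| G, N :!=: 1 & N \proper G]].
  have sNG := normal_sub nNG; have nN := normal_norm nNG.
  rewrite (series_sol nNG); apply/andP; split.
    apply: IH => [|H sHN nnH]; first exact: leq_trans (proper_card pN) leGn.
    by apply: normalS (sHN) (sNG) _; apply: mnh nnH; apply: subset_trans sNG.
  apply: IH => [|H sHG nnH].
    by rewrite -ltnS; apply: leq_trans leGn; rewrite ltnS ltn_quotient.
  (* The preimage of a non-nilpotent subgroup is non-nilpotent, so the hypothesis passes to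
     [G / N]. *)
  have nH : ~~ nilpotent (coset N @*^-1 H).
    by apply: contra nnH => /(quotient_nil N); rewrite cosetpreK.
  rewrite -(cosetpreK H) quotient_normal // mnh //.
  by rewrite -(quotientGK nNG) morphpreS.
exfalso; apply: (@schmidt_absurd gT G) => // [N nNG | H pH].
  have [-> | ntN] := eqVneq (gval N) 1; [by left | right].
  move/existsPn/(_ N): simpleG; rewrite nNG ntN properEneq normal_sub // andbT /=.
  by move/negPn/eqP.
have [// | nnH] := boolP (nilpotent H).
have nHG := mnh H (proper_sub pH) nnH.
move/existsPn/(_ H): simpleG; rewrite nHG pH andbT /= => /negPn/eqP H1.
by rewrite H1 nilpotent1 in nnH.
Qed.

End FiniteMNH.

(** * Modules over the integral Laurent polynomials *)

Section PolyIdeal.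
Import GRing.Theory Num.Theory Order.TTheory.
Local Open Scope ring_scope.
(** The hypotheses describe the contraction to Z[X] of an ideal of Z[X,1/X] whose quotient is a
    field: [IX] cancels [X], and ['X^k - h * g] in [I] says that [g] is invertible once [X] is. *)
Variable I : {poly int} -> Prop.
Hypothesis IB : forall f g, I f -> I g -> I (f - g).
Hypothesis IM : forall h f, I f -> I (h * f).
Hypothesis IX : forall f, I ('X * f) -> I f.
Hypothesis I1 : ~ I 1.
Hypothesis Iunit : forall g, I g \/ exists h k, I ('X^k - h * g).

Lemma ideal_add f g : I f -> I g -> I (f + g).
Proof.
move=> If Ig; have -> : f + g = f - -1 * g by rewrite mulN1r opprK.
by apply: IB => //; apply: IM.
Qed.

Lemma ideal_Xn k f : I ('X^k * f) -> I f.
Proof. by elim: k => [|k IH]; rewrite ?mul1r // exprS -mulrA => /IX. Qed.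

Lemma ideal_cancel k h g f : I ('X^k - h * g) -> I (g * f) -> I f.
Proof.
move=> Iu Igf; apply: (@ideal_Xn k).
rewrite -[_ * f](subrK (h * g * f)) -mulrBl -(mulrA h); apply: ideal_add; last exact: IM.
by rewrite mulrC; apply: IM.
Qed.

(** A prime factor of [n] outside [I] is invertible modulo [I] and can be cancelled; this cannot go
    on down to 1. *)
Lemma ideal_nat_prime n : (0 < n)%N -> I n%:R -> exists2 p, prime p & I p%:R.
Proof.
have [m] := ubnP n; elim: m n => // m IH n lt_nm n_gt0 In.
have [n1 | n_neq1] := eqVneq n 1%N; first by case: I1; rewrite n1 in In.
have n_gt1 : (1 < n)%N by rewrite ltn_neqAle eq_sym n_neq1.
have pr_p := pdiv_prime n_gt1; set p := pdiv n in pr_p.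
have [Ip | [h [k Iu]]] := Iunit p%:R; first by exists p.
have def_n : n = (p * (n %/ p))%N by rewrite mulnC divnK // pdiv_dvd.
apply: (IH (n %/ p)%N).
- by rewrite -ltnS; apply: leq_trans lt_nm; rewrite ltnS ltn_Pdiv // prime_gt1.
- by rewrite divn_gt0 ?prime_gt0 // dvdn_leq // pdiv_dvd.
by apply: (ideal_cancel Iu); rewrite -natrM -def_n.
Qed.

(** Test [2]: if it is invertible instead of being in [I], then ['X^k - h * 2] is non-zero because
    its coefficient at [X^k] is odd. *)
Lemma ideal_nonzero : exists2 f, I f & f != 0.
Proof.
have [I2 | [h [k Iu]]] := Iunit 2%:R; first by exists 2%:R; rewrite // -polyC_natr polyC_eq0.
exists ('X^k - h * 2%:R) => //; apply/eqP => /(congr1 (fun f : {poly int} => f`_k)).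
rewrite coefB coefXn eqxx coef0 mulr_natr coefMn => /eqP; rewrite subr_eq0 => /eqP.
move=> one_eq.
suff: (2 %| 1)%Z by [].
by apply/dvdzP; exists h`_k; rewrite [RHS](mulr_natr _ 2) -one_eq.
Qed.

(* Otherwise pseudo-divide [X^k - h p] by an element [P] of least degree, for a prime [p]
   not dividing [P(0) lc(P)]: modulo [p], [P] divides [lc(P)^m X^k], yet is prime to [X]. *)
Lemma ideal_prime : exists2 p, prime p & I p%:R.
Proof.
apply: contrapT => noP.
have exf : exists n, `[< exists f, [/\ I f, f != 0 & size f = n] >].
  by have [f If nz] := ideal_nonzero; exists (size f); apply/asboolP; exists f.
case: (ex_minnP exf) => d /asboolP[P [IP nzP sP]] minP.
have zero r : I r -> (size r < d)%N -> r = 0.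
  move=> Ir; rewrite ltnNge; have [-> // | nzr] := eqVneq r 0; case/negP.
  by apply: minP; apply/asboolP; exists r.
have P0 : P`_0 != 0.
  apply/negP => /eqP P0; have [Q PQ] : exists Q, P = 'X * Q.
    exists (\poly_(i < (size P).-1) P`_i.+1); apply/polyP=> i.
    rewrite coefXM coef_poly; case: i => [|i] //=.
    case: ltnP => // le_i; rewrite nth_default //.
    by apply: leq_trans (leqSpred _) _; rewrite ltnS.
  have nzQ : Q != 0 by apply: contraNneq nzP => Q0; rewrite PQ Q0 mulr0.
  have := nzQ; rewrite (zero Q) ?eqxx //; first by apply: IX; rewrite -PQ.
  by rewrite -sP PQ mulrC size_mulX // leqnn.
have size_gt1 : (1 < size P)%N.
  rewrite ltnNge; apply/negP => /size1_polyC PC; apply: noP.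
  have [n [n_gt0 In]] : exists n, (0 < n)%N /\ I n%:R.
    exists (absz P`_0); rewrite absz_gt0 P0; split => //.
    have -> : (absz P`_0)%:R = `|P`_0|%:P :> {poly int} by rewrite -abszE -natz polyC_natr.
    case/orP: (le_total 0 P`_0) => c0; first by rewrite ger0_norm // -PC.
    by rewrite ler0_norm // polyCN -PC -mulN1r; apply: IM.
  exact: ideal_nat_prime In.
pose N0 := (absz (P`_0)%R + absz (lead_coef P))%N.
have [p ltp pr_p] := prime_above N0.
have [Ip | [h [k Iu]]] := Iunit p%:R; first by apply: noP; exists p.
set f := 'X^k - _ in Iu.
have nz_intr (c : int) : c != 0 -> (absz c <= N0)%N -> c%:~R != 0 :> 'F_p.
  move=> nzc lec; rewrite -(dvdz_pcharf (pchar_Fp pr_p)); apply/negP => /dvdn_leq.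
  by rewrite absz_gt0 nzc => /(_ isT); rewrite leqNgt (leq_ltn_trans lec).
have nz_lc : (lead_coef P)%:~R != 0 :> 'F_p by apply: nz_intr; rewrite ?lead_coef_eq0 ?leq_addl.
have nz_P0 : (P`_0)%:~R != 0 :> 'F_p by apply: nz_intr; rewrite ?leq_addr.
have := Pdiv.Idomain.divp_eq f P.
rewrite [f %% P]zero ?addr0; first last.
- by rewrite -sP ltn_modp.
- have -> : f %% P = lead_coef P ^+ scalp f P *: f - (f %/ P) * P.
    by rewrite Pdiv.Idomain.divp_eq addrC addKr.
  by apply: IB; [rewrite -mul_polyC|]; apply: IM.
move=> defP; pose red := map_poly (intmul 1 : int -> 'F_p).
have {defP} : red (lead_coef P ^+ scalp f P *: f) = red (f %/ P * P) by rewrite defP.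
have redf : red f = 'X^k.
  rewrite /red /f rmorphB rmorphM /= rmorph_nat map_polyXn -polyC_natr.
  by rewrite (pcharf0 (pchar_Fp pr_p)) polyC0 mulr0 subr0.
rewrite /red map_polyZ rmorphM /= -/(red f) redf.
set Pp := map_poly _ P => defX.
have dvdX : Pp %| 'X^k.
  rewrite -(@dvdpZr _ ((lead_coef P ^+ scalp f P)%:~R)) ?defX ?dvdp_mull //.
  by rewrite rmorphXn expf_neq0.
have copX : coprimep Pp 'X^k.
  rewrite coprimep_expr // coprimep_sym.
  have := coprimep_XsubC Pp 0; rewrite polyC0 subr0 coprimep_sym => ->.
  by rewrite /root horner_coef0 coef_map.
have := copX; rewrite /coprimep (eqp_size (dvdp_gcd_idl dvdX)) => /eqP size1.
move: size_gt1; rewrite -size1 size_poly_eq ?ltnn //.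
Qed.

End PolyIdeal.

(** * The action of Z[X] on an abelian group with an additive map *)

Section PolyAction.
Import GRing.Theory Num.Theory Order.TTheory.
Local Open Scope ring_scope.
Variables (V : zmodType) (phi : V -> V).
Implicit Types f g : {poly int}.
Hypothesis phiD : forall u v, phi (u + v) = phi u + phi v.

Definition pact (f : {poly int}) (v : V) := \sum_(i < size f) iter i phi v *~ f`_i.

Lemma additive0 : phi 0 = 0.
Proof. by apply: (@addrI _ (phi 0)); rewrite -phiD !addr0. Qed.

Lemma additiveN u : phi (- u) = - phi u.
Proof. by apply: (@addrI _ (phi u)); rewrite -phiD !subrr additive0. Qed.

Lemma additiveB u v : phi (u - v) = phi u - phi v.
Proof. by rewrite phiD additiveN. Qed.

Lemma additiveMz u c : phi (u *~ c) = phi u *~ c.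
Proof.
have hn n : phi (u *+ n) = phi u *+ n.
  by elim: n => [|n IH]; rewrite ?additive0 // !mulrS phiD IH.
case: c => n; first exact: hn.
by rewrite NegzE !mulrNz additiveN -[u *~ _]/(u *+ n.+1) hn.
Qed.

Lemma additive_sum J (r : seq J) (P : pred J) (F : J -> V) :
  phi (\sum_(i <- r | P i) F i) = \sum_(i <- r | P i) phi (F i).
Proof. exact: (big_morph phi phiD additive0). Qed.

Lemma pact_widen n f v : (size f <= n)%N -> pact f v = \sum_(i < n) iter i phi v *~ f`_i.
Proof.
move=> le_fn; rewrite /pact (big_ord_widen n (fun i => iter i phi v *~ f`_i) le_fn) big_mkcond.
by apply: eq_bigr => i _; case: ltnP => // le_i; rewrite nth_default // mulr0z.
Qed.

Lemma pact_add f g v : pact (f + g) v = pact f v + pact g v.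
Proof.
pose n := maxn (size f) (size g).
rewrite !(@pact_widen n) ?leq_maxl ?leq_maxr ?(leq_trans (size_polyD _ _)) // -big_split.
by apply: eq_bigr => i _; rewrite coefD mulrzDr.
Qed.

Lemma pact0 v : pact 0 v = 0.
Proof. by rewrite /pact size_poly0 big_ord0. Qed.

Lemma pact_opp f v : pact (- f) v = - pact f v.
Proof. by apply: (@addrI _ (pact f v)); rewrite -pact_add !subrr pact0. Qed.

Lemma pact_sub f g v : pact (f - g) v = pact f v - pact g v.
Proof. by rewrite pact_add pact_opp. Qed.

Lemma pactC c v : pact c%:P v = v *~ c.
Proof. by rewrite (@pact_widen 1) ?size_polyC_leq1 // big_ord1 coefC. Qed.

Lemma pact1 v : pact 1 v = v.
Proof. by rewrite -polyC1 pactC. Qed.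

Lemma pact_Xmul f v : pact ('X * f) v = phi (pact f v).
Proof.
rewrite (@pact_widen (size f).+1); last first.
  by rewrite mulrC (leq_trans (size_polyMleq _ _)) // size_polyX addn2.
rewrite big_ord_recl coefXM /= mulr0z add0r additive_sum.
by apply: eq_bigr => i _; rewrite coefXM /= additiveMz.
Qed.

Lemma pact_mul f g v : pact (f * g) v = pact f (pact g v).
Proof.
elim/poly_ind: f => [|f c IH]; first by rewrite mul0r !pact0.
rewrite mulrDl !pact_add (mulrC f) -mulrA !pact_Xmul IH pactC.
by congr (_ + _); rewrite mul_polyC (@pact_widen (size g)) ?size_scale_leq //
  [pact g v]/pact mulrz_suml; apply: eq_bigr => i _; rewrite coefZ mulrC mulrzA.
Qed.

Lemma pactX v : pact 'X v = phi v.
Proof. by rewrite -[X in pact X]mulr1 pact_Xmul pact1. Qed.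

Lemma pact_Xn k v : pact 'X^k v = iter k phi v.
Proof. by elim: k => [|k IH]; rewrite ?pact1 // exprS pact_Xmul IH. Qed.

Lemma pact_r0 f : pact f 0 = 0.
Proof.
elim/poly_ind: f => [|f c IH]; first by rewrite pact0.
by rewrite pact_add mulrC pact_Xmul IH additive0 pactC mul0rz addr0.
Qed.

Definition phi_sub1 v := phi v - v.

Lemma pact_Xsub1 v : pact ('X - 1) v = phi_sub1 v.
Proof. by rewrite pact_sub pactX pact1. Qed.

Lemma pact_Xsub1n n v : pact (('X - 1) ^+ n) v = iter n phi_sub1 v.
Proof. by elim: n => [|n IH]; rewrite ?pact1 // exprS pact_mul IH pact_Xsub1. Qed.

End PolyAction.

(** * A finite submodule on which [phi - 1] is not nilpotent *)

Section FiniteSubmodule.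
Import GRing.Theory Num.Theory Order.TTheory.
Local Open Scope ring_scope.
Variables (V : zmodType) (phi psi : V -> V).
Implicit Types f g h : {poly int}.
Hypothesis phiD : forall u v, phi (u + v) = phi u + phi v.
Hypothesis phiK : cancel phi psi.
Hypothesis psiK : cancel psi phi.
Local Notation y := (phi_sub1 phi).
(** With [phi] the conjugation by [x] on an abelian normal subgroup, [y] is [u -> [u, x]], and the
    two alternatives come from [<B, x>] being nilpotent or normal. *)
Hypothesis stable_dichotomy : forall B : V -> Prop,
  B 0 -> (forall u v, B u -> B v -> B (u - v)) ->
  (forall u, B u -> B (phi u)) -> (forall u, B u -> B (psi u)) ->
  (exists n, forall b, B b -> iter n y b = 0) \/
  (forall u, exists2 b, B b & y (y u) = y b).
Variable v0 : V.
Hypothesis v0_not_nil : forall n, iter n y v0 <> 0.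

Local Notation act := (pact phi).

Lemma poly_dichotomy f :
  (exists n, act (('X - 1) ^+ n * f) v0 = 0) \/
  (exists g k, act ('X^k * ('X - 1) ^+ 2 - ('X - 1) * g * f) v0 = 0).
Proof.
(* The Z[X,1/X]-submodule generated by [f v0]; the exponent [k] clears denominators. *)
pose B u := exists g k, iter k phi u = act (g * f) v0.
have [|||| [n nilB] | dB] := @stable_dichotomy B.
- by exists 0, 0%N; rewrite mul0r pact0.
- move=> u w [g [k eu]] [h [l ew]]; exists ('X^l * g - 'X^k * h), (l + k)%N.
  rewrite mulrBl -!mulrA pact_sub !(pact_mul phiD 'X^_) -eu -ew !pact_Xn //.
  rewrite -!iterD (addnC k); elim: (l + k)%N => //= n ->; exact: additiveB.
- move=> u [g [k eu]]; exists ('X * g), k.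
  by rewrite -iterSr iterS eu -mulrA pact_Xmul.
- move=> u [g [k eu]]; exists g, k.+1.
  by rewrite iterSr psiK.
- left; exists n; rewrite pact_mul // pact_Xsub1n //; apply: nilB.
  by exists 1, 0%N; rewrite mul1r.
- right; have [b [g [k eb]] yb] := dB v0; exists g, k.
  rewrite pact_sub // pact_mul // pact_Xsub1n // -mulrA pact_mul // -eb /= yb.
  by rewrite -pact_Xsub1 // -[iter k phi b]pact_Xn // -!pact_mul // [in X in _ - X]mulrC subrr.
Qed.

Let v := y (y v0).
Let I (f : {poly int}) := act f v = 0.

Lemma annE f : I f <-> act (f * ('X - 1) ^+ 2) v0 = 0.
Proof. by rewrite pact_mul // pact_Xsub1n. Qed.

Let IB f g : I f -> I g -> I (f - g).
Proof. by rewrite /I pact_sub // => -> ->; rewrite subrr. Qed.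

Let IM h f : I f -> I (h * f).
Proof. by rewrite /I pact_mul // => ->; rewrite pact_r0. Qed.

Let IX f : I ('X * f) -> I f.
Proof. by rewrite /I pact_Xmul // => /(congr1 psi); rewrite phiK -{1}(additive0 phiD) phiK. Qed.

Lemma Xsub1n_notin_ann n : ~ I (('X - 1) ^+ n).
Proof. by rewrite annE -exprD pact_Xsub1n. Qed.

Lemma Xsub1_unit_ann : exists h k, I ('X^k - h * ('X - 1)).
Proof.
have [[n e] | [g [k e]]] := poly_dichotomy (('X - 1) ^+ 2).
  by case: (@Xsub1n_notin_ann n); apply/annE.
by exists g, k; apply/annE; rewrite mulrBl (mulrC g).
Qed.

(** The dichotomy for [g (X - 1)^2] gives either an inverse of [g] modulo [I] or [(X - 1)^n g] in
    [I]. In the latter case the factors [X - 1] are cancelled, being already known to be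
    invertible. *)
Lemma ann_unit g : I g \/ exists h k, I ('X^k - h * g).
Proof.
have [[n e] | [h [k e]]] := poly_dichotomy (g * ('X - 1) ^+ 2); [left | right].
  have {e} : I (('X - 1) ^+ n * g) by apply/annE; rewrite -mulrA.
  have [h [k Iu]] := Xsub1_unit_ann.
  elim: n => [|n IH]; first by rewrite mul1r.
  by rewrite exprS -mulrA => /(ideal_cancel IB IM IX Iu).
by exists (('X - 1) * h), k; apply/annE; rewrite mulrBl -(mulrA _ g).
Qed.

(** [F] is Z[X] v. It is finite because [I] contains a prime [p] and [f = X^k - h (X - 1)], which is
    non-zero modulo [p] since [f(1) = 1]: so [F] is an image of [F_p[X] / (f)], and remainders
    modulo [f] represent all its elements. *)
Lemma finite_submodule : exists S : seq V, exists F : V -> Prop,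
  [/\ forall u, F u -> List.In u S,
      F 0 /\ (forall u w, F u -> F w -> F (u - w)),
      forall u, F u -> F (phi u)
    & exists2 u, F u & forall n, iter n y u <> 0].
Proof.
have nI1 : ~ I 1 by rewrite -(expr0 ('X - 1)); apply: Xsub1n_notin_ann.
have [p pr_p Ip] := ideal_prime IB IM IX nI1 ann_unit.
have [h [k]] := Xsub1_unit_ann; set f := 'X^k - _ => If.
pose red := map_poly (intmul 1 : int -> 'F_p).
pose lift (g : {poly 'F_p}) : {poly int} := map_poly (fun c : 'F_p => (val c)%:Z) g.
have liftK : cancel lift red.
  by move=> g; apply/polyP=> i; rewrite coef_map coef_map_id0 //= -pmulrn natr_Zp.
have red0 g : red g = 0 -> I g.
  move=> rg0; suff [s ->] : exists s, g = s * p%:R by apply: IM.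
  exists (\poly_(i < size g) (g`_i %/ p%:Z)%Z); apply/polyP=> i.
  rewrite mulr_natr coefMn coef_poly; case: ltnP => [_ | le_i]; last by rewrite nth_default ?mul0rn.
  rewrite -mulr_natr natz divzK //.
  have := congr1 (fun q : {poly 'F_p} => q`_i) rg0; rewrite /red coef_map coef0 /= => /eqP.
  by rewrite -(dvdz_pcharf (pchar_Fp pr_p)).
have redf : red f != 0.
  apply/eqP => /(congr1 (fun q => q.[1])); rewrite /red /f rmorphB rmorphM rmorphB /=.
  rewrite map_polyXn map_polyX rmorph1 !hornerE expr1n subrr mulr0 subr0.
  by move/eqP; rewrite oner_eq0.
pose e := size (red f).
pose val_of (c : {ffun 'I_e -> 'F_p}) := act (lift (\sum_(i < e) c i *: 'X^i)) v.
exists (List.map val_of (enum {ffun 'I_e -> 'F_p})), (fun u => exists g, u = act g v).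
split.
- move=> _ [g ->]; pose r := red g %% red f.
  have -> : act g v = val_of [ffun i : 'I_e => r`_i].
    apply/eqP; rewrite -subr_eq0 -pact_sub //; apply/eqP.
    have -> : \sum_(i < e) [ffun i0 : 'I_e => r`_i0] i *: 'X^i = r.
      rewrite -[RHS]coefK poly_def; under eq_bigr do rewrite ffunE.
      have le_re : (size r <= e)%N by apply: ltnW; rewrite ltn_modp.
      rewrite (big_ord_widen e (fun i => r`_i *: 'X^i) le_re) [RHS]big_mkcond.
      by apply: eq_bigr => i _; case: ltnP => // le_i; rewrite nth_default // scale0r.
    have -> : g - lift r = (g - lift r - lift (red g %/ red f) * f) + lift (red g %/ red f) * f.
      by rewrite subrK.
    rewrite pact_add // [X in _ + X](IM _ If) addr0; apply: red0.
    have rB a b : red (a - b) = red a - red b by rewrite /red rmorphB.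
    have rM a b : red (a * b) = red a * red b by rewrite /red rmorphM.
    by rewrite 2!rB rM !liftK {1}(divp_eq (red g) (red f)) -/r addrK subrr.
  apply: List.in_map; set c := [ffun i => _].
  have: c \in enum {ffun 'I_e -> 'F_p} by rewrite mem_enum.
  elim: (enum _) => //= a s IHs; rewrite in_cons => /orP[/eqP-> | /IHs]; by [left | right].
- split; first by exists 0; rewrite pact0.
  by move=> _ _ [g ->] [g' ->]; exists (g - g'); rewrite pact_sub.
- by move=> _ [g ->]; exists ('X * g); rewrite pact_Xmul.
exists v; first by exists 1; rewrite pact1.
by move=> n; rewrite /v -!iterSr; apply: v0_not_nil.
Qed.

End FiniteSubmodule.

(* Required only here, since its [nilpotent], [center], [subset], ... hide those above. *)
Require Import Defs.

(** * Central series *)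

Declare Scope grp_scope.
Delimit Scope grp_scope with grp.
Local Notation "x * y" := (mul _ x y) : grp_scope.
Local Notation "x ^-1" := (inv _ x) : grp_scope.
Local Notation "1" := (one _) : grp_scope.
Local Notation sg := (is_subgroup _).
Local Notation gen := (generated _).
Local Notation "[ 'c' x , y ]" := (comm _ x y) (at level 0, x, y at level 99) : grp_scope.

Section Laws.
Variable G : Group.
Implicit Types x y z : G.
Local Open Scope grp_scope.

Lemma gmulA x y z : (x * y) * z = x * (y * z). Proof. by rewrite mulA. Qed.
Lemma gmul1 x : 1 * x = x. Proof. exact: mul1g. Qed.
Lemma gmulV x : x^-1 * x = 1. Proof. exact: mulVg. Qed.
Lemma gmulKV x y : x^-1 * (x * y) = y. Proof. by rewrite mulA mulVg mul1g. Qed.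
Lemma gmulrV x : x * x^-1 = 1.
Proof. by rewrite -[LHS](gmulKV x^-1) (gmulKV x) gmulV. Qed.
Lemma gmulr1 x : x * 1 = x.
Proof. by rewrite -(gmulV x) mulA gmulrV gmul1. Qed.
Lemma gmulK x y : x * (x^-1 * y) = y.
Proof. by rewrite mulA gmulrV gmul1. Qed.
Lemma gmulI x y z : x * y = x * z -> y = z.
Proof. by move=> e; rewrite -(gmulKV x y) e gmulKV. Qed.
Lemma ginv1 : (1 : G)^-1 = 1. Proof. by rewrite -[LHS]gmulr1 gmulV. Qed.
Lemma ginvK x : x^-1^-1 = x.
Proof. by apply: (@gmulI x^-1); rewrite gmulrV gmulV. Qed.
Lemma ginvM x y : (x * y)^-1 = y^-1 * x^-1.
Proof. by apply: (@gmulI (x * y)); rewrite gmulrV gmulA gmulK gmulrV. Qed.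

End Laws.

(* The ten rules of the complete rewriting system for groups: words equal in the free group get the
   same normal form, so [geq] and [ceq] decide such identities. *)
#[local] Hint Rewrite gmulA gmul1 gmulV gmulKV gmulr1 gmulrV gmulK ginv1 ginvK ginvM : gsimp.
Ltac gsimp := rewrite /comm; autorewrite with gsimp.
Ltac geq := solve [by gsimp].

Definition gconj (G : Group) (u x : G) : G := (x^-1 * u * x)%grp.
Local Notation "u ^ x" := (gconj u x) : grp_scope.
Ltac ceq := solve [rewrite /gconj; by gsimp].

Section Basics.
Variable G : Group.
Implicit Types (x y z u h : G) (A B H K N : gset G).
Local Open Scope grp_scope.

Lemma sg1 H : sg H -> H 1. Proof. by case. Qed.
Lemma sgM H x y : sg H -> H x -> H y -> H (x * y). Proof. by case=> _ [h _]; apply: h. Qed.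
Lemma sgV H x : sg H -> H x -> H x^-1. Proof. by case=> _ [_ h]; apply: h. Qed.
Lemma sgJ H x y : sg H -> H x -> H y -> H (x ^ y).
Proof. by move=> sH Hx Hy; do 2![apply: sgM => //]; apply: sgV. Qed.
Lemma sgR H x y : sg H -> H x -> H y -> H [c x, y].
Proof. by move=> sH Hx Hy; do 3![apply: sgM => //]; apply: sgV. Qed.
Lemma sgMl H x y : sg H -> H x -> H (x * y) -> H y.
Proof. by move=> sH Hx Hxy; rewrite -(gmulKV x y); apply: sgM (sgV _ _) _. Qed.
Lemma sgT : sg (setT G). Proof. by []. Qed.

Lemma trivial_sg : sg (fun y : G => y = 1).
Proof. by split=> //; split=> [u v -> -> | u ->]; geq. Qed.

Lemma gen_sg A : sg (gen A).
Proof.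
split; first by move=> H sH _; apply: sg1.
split=> [x y gx gy | x gx] H sH sAH; first by apply: sgM; [|apply: gx|apply: gy].
by apply: sgV; [|apply: gx].
Qed.

Lemma gen_in A x : A x -> gen A x. Proof. by move=> Ax H _; apply. Qed.

Lemma gen_min A H : sg H -> subset _ A H -> subset _ (gen A) H.
Proof. by move=> sH sAH x; apply. Qed.

Lemma gen_mono A B : subset _ A B -> subset _ (gen A) (gen B).
Proof. by move=> sAB; apply: gen_min (gen_sg _) _ => x /sAB; apply: gen_in. Qed.

Lemma conjM u v x : (u * v) ^ x = u ^ x * v ^ x. Proof. by ceq. Qed.
Lemma conjV u x : u^-1 ^ x = (u ^ x)^-1. Proof. by ceq. Qed.
Lemma conj1g x : 1 ^ x = 1 :> G. Proof. by ceq. Qed.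
Lemma conjg1 u : u ^ 1 = u. Proof. by ceq. Qed.
Lemma conjJM u x y : u ^ (x * y) = (u ^ x) ^ y. Proof. by ceq. Qed.
Lemma conjK u x : (u ^ x) ^ x^-1 = u. Proof. by ceq. Qed.
Lemma conjKV u x : (u ^ x^-1) ^ x = u. Proof. by ceq. Qed.
Lemma conj_comm u x : u ^ x = u * [c u, x]. Proof. by ceq. Qed.
Lemma comm_conj u x : [c u, x] = u^-1 * u ^ x. Proof. by ceq. Qed.
Lemma conjR u v x : [c u, v] ^ x = [c u ^ x, v ^ x]. Proof. by ceq. Qed.
Lemma commMl u v x : [c u * v, x] = [c u, x] ^ v * [c v, x]. Proof. by ceq. Qed.
Lemma commMr u x y : [c u, x * y] = [c u, y] * [c u, x] ^ y. Proof. by ceq. Qed.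
Lemma commVl u x : [c u^-1, x] = ([c u, x]^-1) ^ u^-1. Proof. by ceq. Qed.
Lemma commVr u x : [c u, x^-1] = ([c u, x]^-1) ^ x^-1. Proof. by ceq. Qed.
Lemma comm1l x : [c 1, x] = 1 :> G. Proof. by ceq. Qed.
Lemma comm1r x : [c x, 1] = 1 :> G. Proof. by ceq. Qed.
Lemma commV u x : [c u, x]^-1 = [c x, u]. Proof. by ceq. Qed.
Lemma commgg x : [c x, x] = 1. Proof. by ceq. Qed.

Lemma comm_eq1 x y : [c x, y] = 1 <-> x * y = y * x.
Proof.
split=> [e | e]; last by rewrite /comm gmulA e; geq.
have -> : x * y = y * x * [c x, y] by geq.
by rewrite e gmulr1.
Qed.

Lemma conj_eq_comm u x : u ^ x = u <-> u * x = x * u.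
Proof.
rewrite -comm_eq1 comm_conj; split=> [-> | e]; first by geq.
by rewrite -(gmulK u (u ^ x)) e gmulr1.
Qed.

Lemma sg_conj H x : sg H -> sg (fun u => H (u ^ x)).
Proof.
move=> sH; split; first by rewrite conj1g; apply: sg1.
by split=> [u v Hu Hv | u Hu]; [rewrite conjM; apply: sgM | rewrite conjV; apply: sgV].
Qed.

Definition normalised N H := forall u h, H h -> N u -> N (u ^ h).

(** Both [a] and its inverse are required, since conjugation by [a] alone may map an infinite [N]
    properly into itself. *)
Lemma normalised_gen N A : sg N ->
  (forall u a, A a -> N u -> N (u ^ a) /\ N (u ^ a^-1)) -> normalised N (gen A).
Proof.
move=> sN nA u h gh Nu.
pose S h := forall u, N u -> N (u ^ h) /\ N (u ^ h^-1).
suff Sh : S h by case: (Sh u Nu).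
apply: gh => [|a Aa v Nv]; last exact: nA.
split; first by move=> v; rewrite ginv1 !conjg1.
split=> [a b na nb v Nv | a na v Nv]; last by rewrite ginvK; case: (na v Nv).
rewrite ginvM !conjJM; split; first by case: (na v Nv) => /nb[].
by case: (nb v Nv) => _ /na[].
Qed.

Lemma gen_normalised A H : sg H -> (forall a h, H h -> A a -> gen A (a ^ h)) ->
  normalised (gen A) H.
Proof.
by move=> sH nA u h Hh gu; apply: (gu _ (sg_conj h (gen_sg A))) => a; apply: nA.
Qed.

(** This is the centraliser of [u] in [H] modulo [N]; being a subgroup, it reduces statements on
    commutators to generators. *)
Lemma comm_subgroup_r N H u : sg N -> sg H -> normalised N H ->
  sg (fun h => H h /\ N [c u, h]).
Proof.
move=> sN sH nN; split; first by rewrite comm1r; split; apply: sg1.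
split=> [x y [Hx Nx] [Hy Ny] | x [Hx Nx]].
  by split; [apply: sgM | rewrite commMr; apply: sgM => //; apply: nN].
split; first exact: sgV.
by rewrite commVr; apply: nN; apply: sgV.
Qed.

Lemma comm_subgroup_l N H h : sg N -> sg H -> normalised N H ->
  sg (fun u => H u /\ N [c u, h]).
Proof.
move=> sN sH nN; split; first by rewrite comm1l; split; apply: sg1.
split=> [x y [Hx Nx] [Hy Ny] | x [Hx Nx]].
  by split; [apply: sgM | rewrite commMl; apply: sgM => //; apply: nN].
split; first exact: sgV.
by rewrite commVl; apply: nN; apply: sgV.
Qed.

Lemma comm_gen_r N A u : sg N -> normalised N (gen A) ->
  (forall a, A a -> N [c u, a]) -> forall h, gen A h -> N [c u, h].
Proof.
move=> sN nN cA h gh.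
have [|//] := gh _ (comm_subgroup_r u sN (gen_sg A) nN).
by move=> a Aa; split; [apply: gen_in | apply: cA].
Qed.

Lemma commsub_in A B a b : A a -> B b -> commsub _ A B [c a, b].
Proof. by move=> Aa Bb; apply: gen_in; exists a, b. Qed.

Lemma commsub_min A B H : sg H -> (forall a b, A a -> B b -> H [c a, b]) ->
  subset _ (commsub _ A B) H.
Proof. by move=> sH cAB; apply: gen_min => // _ [a [b [Aa [Bb ->]]]]; apply: cAB. Qed.

Lemma commsub_mono A A' B B' : subset _ A A' -> subset _ B B' ->
  subset _ (commsub _ A B) (commsub _ A' B').
Proof.
move=> sA sB; apply: commsub_min (gen_sg _) _ => a b /sA Aa /sB Bb.
exact: commsub_in.
Qed.

Lemma commsub_normalised A B H : sg H -> normalised A H -> normalised B H ->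
  normalised (commsub _ A B) H.
Proof.
move=> sH nA nB; apply: gen_normalised => // _ h Hh [a [b [Aa [Bb ->]]]].
by rewrite conjR; apply: commsub_in; [apply: nA | apply: nB].
Qed.

Lemma derived_sg H n : sg H -> sg (derived _ H n).
Proof. by case: n => // n _; apply: gen_sg. Qed.

Lemma lcs_normalised H K n : sg K -> normalised H K -> normalised (lcs _ H n) K.
Proof. by move=> sK nHK; elim: n => //= n IH; apply: commsub_normalised. Qed.

Lemma derived_normalised H K n : sg K -> normalised H K -> normalised (derived _ H n) K.
Proof. by move=> sK nHK; elim: n => //= n IH; apply: commsub_normalised. Qed.

Lemma lcs_sub H n : sg H -> subset _ (lcs _ H n) H.
Proof.
move=> sH; elim: n => //= n IH; apply: commsub_min => // a b /IH Ha Hb; exact: sgR.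
Qed.

Lemma derived_sub H n : sg H -> subset _ (derived _ H n) H.
Proof.
move=> sH; elim: n => //= n IH; apply: commsub_min => // a b /IH Ha /IH Hb; exact: sgR.
Qed.

Lemma lcs_mono H K n : subset _ H K -> subset _ (lcs _ H n) (lcs _ K n).
Proof. by move=> sHK; elim: n => //= n IH; apply: commsub_mono. Qed.

Lemma derived_mono H K n : subset _ H K -> subset _ (derived _ H n) (derived _ K n).
Proof. by move=> sHK; elim: n => //= n IH; apply: commsub_mono. Qed.

Lemma nilpotentS H K : subset _ K H -> nilpotent _ H -> nilpotent _ K.
Proof. by move=> sKH [n tn]; exists n => x /(lcs_mono sKH)/tn. Qed.

Lemma normalised_derived n : normalised (derived _ (setT G) n) (setT G).
Proof. exact: derived_normalised. Qed.

Fixpoint ucs H n : gset G :=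
  if n is m.+1 then fun g => H g /\ forall h, H h -> ucs H m [c g, h]
  else fun g => g = 1.

Lemma ucs_props H n : sg H ->
  [/\ sg (ucs H n), normalised (ucs H n) H & subset _ (ucs H n) H].
Proof.
move=> sH; elim: n => [|n [sU nU _]] /=.
  split; last by move=> x ->; apply: sg1.
    exact: trivial_sg.
  by move=> u h _ ->; rewrite conj1g.
split; last by move=> x [].
  split; first by split=> [|h Hh]; rewrite ?comm1l; apply: sg1.
  split=> [x y [Hx cx] [Hy cy] | x [Hx cx]].
    by split=> [|h Hh]; [apply: sgM | rewrite commMl; apply: sgM => //; [apply: nU|]; auto].
  split=> [|h Hh]; first exact: sgV.
  by rewrite commVl; apply: nU; [apply: sgV | apply: sgV; auto].
move=> u k Hk [Hu cu]; split=> [|h Hh]; first exact: sgJ.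
rewrite -[h](conjKV _ k) -conjR; apply: nU => //; apply: cu.
by apply: sgJ => //; apply: sgV.
Qed.

Lemma ucs_sg H n : sg H -> sg (ucs H n).
Proof. by move=> sH; case: (ucs_props n sH). Qed.

Lemma ucs_mono H m n : sg H -> m <= n -> subset _ (ucs H m) (ucs H n).
Proof.
move=> sH; have step k : subset _ (ucs H k) (ucs H k.+1).
  move=> x Ux; have [sU nU sUH] := ucs_props k sH.
  split; first exact: sUH.
  by move=> h Hh; rewrite comm_conj; apply: sgM (sgV _ _) (nU _ _ _ _).
elim: n => [|n IH]; first by rewrite leqn0 => /eqP-> x.
by rewrite leq_eqVlt => /orP[/eqP-> x // | /IH h] x /h/step.
Qed.

Lemma lcs_ucs H n i : sg H -> trivial_set _ (lcs _ H n) -> i <= n ->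
  subset _ (lcs _ H (n - i)) (ucs H i).
Proof.
move=> sH tn; elim: i => [|i IH] lt_in x Lx; first by apply: tn; rewrite subn0 in Lx.
split; first exact: lcs_sub Lx.
move=> h Hh; apply: IH; first exact: ltnW.
by rewrite -(subnSK lt_in) /=; apply: commsub_in.
Qed.

Lemma nilpotent_ucs H : sg H -> nilpotent _ H <-> exists n, subset _ H (ucs H n).
Proof.
move=> sH; split=> [[n tn] | [n sHU]].
  by exists n => x Hx; apply: (lcs_ucs sH tn (leqnn n)); rewrite subnn.
exists n; suff sLU i : i <= n -> subset _ (lcs _ H i) (ucs H (n - i)).
  by move=> x /(sLU n (leqnn n)); rewrite subnn.
elim: i => [|i IH] lt_in; first by rewrite subn0.
apply: commsub_min (ucs_sg _ sH) _ => a b /(IH (ltnW lt_in)).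
by rewrite -(subnSK lt_in) /= => -[Ha ca] /ca.
Qed.

Lemma nilpotent_gen_ucs A n : subset _ A (ucs (gen A) n) -> nilpotent _ (gen A).
Proof.
move=> sA; apply/(nilpotent_ucs (gen_sg A)); exists n.
by apply: gen_min => //; apply: ucs_sg (gen_sg A).
Qed.

(** Membership in an upper central term can be tested on generators, which is why nilpotency is
    handled through [ucs] rather than [lcs]. *)
Lemma ucs_gen_step A n u : gen A u ->
  (forall a, A a -> ucs (gen A) n [c u, a]) -> ucs (gen A) n.+1 u.
Proof.
move=> gu cu; split=> // h gh.
have [sU nU _] := ucs_props n (gen_sg A); exact: comm_gen_r gh.
Qed.

(** The element [x] may lie outside [H]: conjugation by it is an automorphism of [H], and upper
    central terms are characteristic. *)
Lemma ucs_conj H n u x : sg H -> (forall h, H h -> H (h ^ x) /\ H (h ^ x^-1)) ->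
  ucs H n u -> ucs H n (u ^ x).
Proof.
move=> sH nH; elim: n u => [u -> | n IH u [Hu cu]] /=; first by rewrite conj1g.
split=> [|h Hh]; first by case: (nH u Hu).
by rewrite -[h](conjKV _ x) -conjR; apply: IH; apply: cu; case: (nH h Hh).
Qed.

End Basics.
#[local] Arguments sgT {G}.
#[local] Arguments trivial_sg {G}.

(** * Engel elements and local nilpotency *)

Section Engel.
Variable G : Group.
Implicit Types (x y z u h b : G) (A B H K L M N : gset G) (l : list G).
Local Open Scope grp_scope.

Definition elts l : gset G := fun y => List.In y l.

Fixpoint eng u x n : G := if n is m.+1 then [c eng u x m, x] else u.

Definition engel_on x B := forall b, B b -> exists n, eng b x n = 1.

Definition locally_nilpotent L :=
  forall l, subset _ (elts l) L -> nilpotent _ (gen (elts l)).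

Lemma engS u x n : eng u x n.+1 = eng [c u, x] x n.
Proof. by elim: n => //= n ->. Qed.

Lemma engD u x m n : eng u x (m + n) = eng (eng u x n) x m.
Proof. by elim: m => //= m ->. Qed.

Lemma list_bound T (P : T -> nat -> Prop) (l : list T) :
  (forall t m n, m <= n -> P t m -> P t n) ->
  (forall t, List.In t l -> exists n, P t n) -> exists n, forall t, List.In t l -> P t n.
Proof.
move=> mono; elim: l => [|a l IH] h; first by exists 0.
have [|n hn] := IH; first by move=> t lt; apply: h; right.
have [|m hm] := h a; first by left.
exists (maxn m n) => t [<- | /hn]; first exact: mono (leq_maxl m n) hm.
exact: mono (leq_maxr m n).
Qed.

(** Adjoin to [l] the iterated commutators of its elements with [x]; the Engel condition stops each
    chain at 1. *)
Lemma engel_closure L x l : engel_on x L -> (forall u, L u -> L [c u, x]) ->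
  subset _ (elts l) L -> exists l', [/\ subset _ (elts l) (elts l'), subset _ (elts l') L &
    forall u, elts l' u -> [c u, x] = 1 \/ elts l' [c u, x]].
Proof.
move=> eL cL; elim: l => [|b l IH] sl; first by exists nil; split.
have [|l' [sll' sl'L cl']] := IH; first by move=> u lu; apply: sl; right.
have Lb : L b by apply: sl; left.
have [n] := eL b Lb; elim: n b Lb {sl IH} => [|n IHn] b Lb.
  move=> /= b1; exists (b :: l')%SEQ; split.
  - by move=> u [-> | /sll' lu]; [left | right].
  - by move=> u [<- | /sl'L].
  - by move=> u [<- | /cl'[cu | cu]]; [rewrite b1 comm1l; left | left | right; right].
rewrite engS => /(IHn _ (cL b Lb))[l2 [sl2 sl2L cl2]].
exists (b :: l2)%SEQ; split.
- by move=> u [-> | lu]; [left | right; apply: sl2; right].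
- by move=> u [<- | /sl2L].
- move=> u [<- | /cl2[cu | cu]]; [right | by left | by right; right].
  by right; apply: sl2; left.
Qed.

(* With [B] the subgroup generated by the iterated commutators of [l] with [x], each term of
   the upper central series of [B] lies in the union of that of [<B, x>]: to place [u] there
   one only needs its commutators with the finitely many generators. *)
Lemma engel_ext L x l : sg L -> locally_nilpotent L -> engel_on x L ->
  (forall u, L u -> L (u ^ x)) -> subset _ (elts l) L ->
  nilpotent _ (gen (fun y => y = x \/ elts l y)).
Proof.
move=> sL nL eL nLx sl.
have cL u : L u -> L [c u, x] by move=> Lu; rewrite comm_conj; apply: sgM (sgV _ _) (nLx _ _).
have [l' [sll' sl'L cl']] := engel_closure eL cL sl.
set B := gen (elts l'); have sB : sg B := gen_sg _.
have sBL : subset _ B L by apply: gen_min.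
have cB u : elts l' u -> B [c u, x].
  by case/cl'=> [->|]; [apply: sg1 | apply: gen_in].
(* For the inverse of [x], conjugating a generator [b] leads to the same question for [[b, x]],
   whose chain of commutators is shorter. *)
have BJ u : B u -> B (u ^ x) /\ B (u ^ x^-1).
  move=> Bu; split.
    apply: (Bu _ (sg_conj x sB)) => b lb.
    by rewrite conj_comm; apply: sgM (gen_in _) (cB _ _).
  apply: (Bu _ (sg_conj x^-1 sB)) => b lb.
  have [n] := eL b (sl'L b lb); elim: n b lb => [b _ /= -> | n IH b lb].
    by rewrite conj1g; apply: sg1.
  rewrite engS => en; have -> : b ^ x^-1 = b * ([c b, x] ^ x^-1)^-1 by ceq.
  apply: sgM (gen_in lb) (sgV _ _) => //.
  by case: (cl' b lb) => [-> | lc]; [rewrite conj1g; apply: sg1 | apply: IH].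
pose A y := y = x \/ elts l' y; set X := gen A; have sX : sg X := gen_sg _.
have sBX : subset _ B X by apply: gen_mono => u; right.
have [c sBc] := (nilpotent_ucs sB).1 (nL _ sl'L).
(* Double induction: on [i] for the commutators with generators of [B], on the Engel length of [u]
   for the commutator with [x]. *)
have ucsBX i u : ucs B i u -> exists k, ucs X k u.
  elim: i u => [u -> | i IHi u Uu]; first by exists 0.
  have Bu : B u by case: Uu.
  have [n] := eL u (sBL u Bu); elim: n u Uu {Bu} => [u _ /= -> | n IHn u Uu].
    by exists 0.
  rewrite engS => en; have Bu : B u by case: Uu.
  have [sU nU _] := ucs_props i.+1 sB.
  have [|k1 hk1] := IHn [c u, x] _ en.
    by rewrite comm_conj; apply: sgM (sgV _ _) (ucs_conj _ _ _).
  have [||k2 hk2] := @list_bound _ (fun b k => ucs X k [c u, b]) l'.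
  - by move=> b m k le_mk; apply: ucs_mono.
  - by move=> b lb; apply: IHi; case: Uu => _; apply; apply: gen_in.
  exists (maxn k1 k2).+1; apply: ucs_gen_step; first exact: sBX.
  move=> a [-> | la]; first exact: ucs_mono (leq_maxl k1 k2) _ hk1.
  exact: ucs_mono (leq_maxr k1 k2) _ (hk2 a la).
have [||k hk] := @list_bound _ (fun b k => ucs X k b) l'.
- by move=> b m k le_mk; apply: ucs_mono.
- by move=> b lb; apply: (@ucsBX c); apply: sBc; apply: gen_in.
have nX : nilpotent _ X.
  apply: (@nilpotent_gen_ucs _ _ k.+1) => u [-> | lu]; last exact: ucs_mono (leqnSn k) _ (hk u lu).
  have Xx : X x by apply: gen_in; left.
  apply: ucs_gen_step => // a [-> | la]; first by rewrite commgg; apply: sg1 (ucs_sg k sX).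
  have [sU nU _] := ucs_props k sX.
  have -> : [c x, a] = (a ^ x)^-1 * a by ceq.
  by apply: sgM (sgV _ (nU _ _ _ _)) (hk a la) => //; apply: hk.
by apply: nilpotentS nX; apply: gen_mono => y [-> | /sll']; [left | right].
Qed.

(** A word has finitely many letters, so a finitely generated subgroup of [<x, L>] lies in one
    treated by [engel_ext]. *)
Lemma gen_finite_support A l x : subset _ (elts l) (gen (fun y => y = x \/ A y)) ->
  exists2 l0, subset _ (elts l0) A &
    subset _ (elts l) (gen (fun y => y = x \/ elts l0 y)).
Proof.
pose S u := exists2 l0, subset _ (elts l0) A & gen (fun y => y = x \/ elts l0 y) u.
have catP l1 l2 u : (elts (l1 ++ l2)%SEQ u : Prop) <-> elts l1 u \/ elts l2 u.
  by apply: List.in_app_iff.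
have gen_cat l1 l2 u : gen (fun y => y = x \/ elts l1 y) u \/ gen (fun y => y = x \/ elts l2 y) u ->
    gen (fun y => y = x \/ elts (l1 ++ l2)%SEQ y) u.
  by case; apply: gen_mono => y [-> | ly]; try (by left); right; apply/catP; [left | right].
have sub_cat l1 l2 : subset _ (elts l1) A -> subset _ (elts l2) A -> subset _ (elts (l1 ++ l2)%SEQ) A.
  by move=> s1 s2 u /catP[/s1|/s2].
have sS : sg S.
  split; first by exists nil => //; apply: sg1 (gen_sg _).
  split=> [u v [l1 s1 g1] [l2 s2 g2] | u [l1 s1 g1]]; last by exists l1; rewrite //; apply: sgV (gen_sg _) _.
  exists (l1 ++ l2)%SEQ; first exact: sub_cat.
  by apply: sgM (gen_sg _) _ _; apply: gen_cat; [left | right].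
have genS u : gen (fun y => y = x \/ A y) u -> S u.
  apply: gen_min => // y [-> | Ay]; first by exists nil => //; apply: gen_in; left.
  by exists (y :: nil)%SEQ => [z [<-|] | ] //; apply: gen_in; right; left.
elim: l => [|a l IH] sl; first by exists nil.
have [|l1 s1 g1] := IH; first by move=> u lu; apply: sl; right.
have [|l2 s2 g2] := genS a; first by apply: sl; left.
exists (l1 ++ l2)%SEQ; first exact: sub_cat.
by move=> u [<- | lu]; apply: gen_cat; [right | left; apply: g1].
Qed.

Lemma locally_nilpotent_adjoin L x : sg L -> locally_nilpotent L -> engel_on x L ->
  (forall u, L u -> L (u ^ x)) -> locally_nilpotent (gen (fun y => y = x \/ L y)).
Proof.
move=> sL nL eL nLx l /gen_finite_support[l0 s0 g0].
by apply: nilpotentS (engel_ext sL nL eL nLx s0); apply: gen_min (gen_sg _) _.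
Qed.

Lemma locally_nilpotentS L K : subset _ K L -> locally_nilpotent L -> locally_nilpotent K.
Proof. by move=> sKL nL l sl; apply: nL => u /sl/sKL. Qed.

(** Generators are adjoined to [L] one at a time. Each intermediate group contains [L], hence all
    commutators of [K], so the next generator normalises it. *)
Lemma locally_nilpotent_abelian_ext L K : sg L -> sg K -> subset _ L K ->
  (forall a b, K a -> K b -> L [c a, b]) -> locally_nilpotent L ->
  (forall x, K x -> engel_on x K) -> locally_nilpotent K.
Proof.
move=> sL sK sLK cK nL eK l sl.
suff: locally_nilpotent (gen (fun y => elts l y \/ L y)).
  by apply=> y ly; apply: gen_in; left.
elim: l sl => [|x l IH] sl.
  by apply: locally_nilpotentS nL; apply: gen_min => // y [].
have Kx : K x by apply: sl; left.
have {}IH := IH (fun u lu => sl u (or_intror lu)).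
set M := gen _ in IH; have sM : sg M := gen_sg _.
have sMK : subset _ M K by apply: gen_min => // y [ly | /sLK //]; apply: sl; right.
apply: locally_nilpotentS (@locally_nilpotent_adjoin M x sM IH _ _).
- apply: gen_min (gen_sg _) _ => y [[<- | ly] | Ly]; apply: gen_in; [by left | right..].
    by apply: gen_in; left.
  by apply: gen_in; right.
- by move=> u /sMK; apply: (eK x Kx).
move=> u Mu; rewrite conj_comm; apply: (sgM sM) => //; apply: gen_in; right.
by apply: cK => //; apply: sMK.
Qed.

Lemma soluble_engel_locally_nilpotent : soluble _ (setT G) ->
  (forall x, engel_on x (setT G)) -> locally_nilpotent (setT G).
Proof.
move=> [n tn] eG.
suff lnD k : k <= n -> locally_nilpotent (derived _ (setT G) (n - k)).
  by have := lnD n (leqnn n); rewrite subnn.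
elim: k => [_ | k IHk le_kn].
  rewrite subn0 => l sl; exists 0 => x /= gx; apply: tn.
  by move: x gx; apply: gen_min => //; apply: derived_sg _ (@sgT G).
have := IHk (ltnW le_kn); set m := (n - k.+1)%N.
have -> : (n - k)%N = m.+1 by rewrite /m subnSK.
move=> IH; apply: locally_nilpotent_abelian_ext (IH) _.
- exact: derived_sg _ (@sgT G).
- exact: derived_sg _ (@sgT G).
- apply: commsub_min (derived_sg m (@sgT G)) _ => a b; exact: sgR (derived_sg m (@sgT G)).
- by move=> a b Ka Kb; apply: commsub_in.
by move=> x _ u _; apply: eG.
Qed.

End Engel.

(** * The Fitting subgroup *)

Section Fitting.
Variable G : Group.
Implicit Types (x y z u h b : G) (A B H K L M N : gset G) (l : list G).
Local Open Scope grp_scope.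

Lemma normalP N : normal_in _ N (setT G) <-> sg N /\ normalised N (setT G).
Proof.
split=> [[sN [_ nN]] | [sN nN]]; first by split=> // u h _; apply: nN.
by split=> //; split=> // k h _ Nh; apply: nN.
Qed.

Definition mulset M N : gset G := gen (fun y => M y \/ N y).

Lemma mulset_normal M N : sg M -> sg N -> normalised M (setT G) -> normalised N (setT G) ->
  normalised (mulset M N) (setT G).
Proof.
move=> sM sN nM nN; rewrite /mulset; apply: gen_normalised sgT _ => a h _.
by case=> ?; apply: gen_in; [left; apply: nM | right; apply: nN].
Qed.

(* By descending the upper central series of [M] and the lower central series of [N]. *)
Lemma fitting_half M N : sg M -> sg N -> normalised M (setT G) -> normalised N (setT G) ->
  nilpotent _ M -> nilpotent _ N -> exists k, subset _ M (ucs (mulset M N) k).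
Proof.
move=> sM sN nM nN nilM [c tc]; set L := mulset M N; have sL : sg L := gen_sg _.
have [d sMd] := (nilpotent_ucs sM).1 nilM.
have MJ n u h : ucs M n u -> ucs M n (u ^ h).
  by apply: ucs_conj => // v Mv; split; apply: nM.
have NJ n : normalised (lcs _ N n) (setT G) by apply: lcs_normalised.
have MR n u h : ucs M n u -> ucs M n [c u, h].
  by move=> Uu; rewrite comm_conj; have sU := ucs_sg n sM; apply: sgM (sgV _ _) (MJ _ _ _ _).
have sML : subset _ M L by move=> u Mu; apply: gen_in; left.
(* An inner induction along the lower central series of [N]: it starts at the trivial term of index
   [c], and commutation with [N] leads one term further down. *)
have step i k : (forall u, ucs M i u -> ucs L k u) ->
    forall j, j <= c -> exists k', forall u, ucs M i.+1 u -> lcs _ N (c - j) u -> ucs L k' u.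
  move=> hi; elim=> [|j IHj] lt_jc.
    by exists 0 => u _; rewrite subn0 => /tc.
  have [k' hk'] := IHj (ltnW lt_jc); exists (maxn k k').+1 => u Uu Lu.
  apply: ucs_gen_step; first by apply: sML; case: Uu.
  move=> a [Ma | Na].
    by apply: (ucs_mono sL (leq_maxl k k')); apply: hi; case: Uu => _; apply.
  apply: (ucs_mono sL (leq_maxr k k')); apply: hk'; first exact: MR.
  by rewrite -(subnSK lt_jc) /=; apply: commsub_in.
suff [k hk] : exists k, forall u, ucs M d u -> ucs L k u by exists k => u /sMd/hk.
elim: d {sMd} => [|i [k hi]]; first by exists 0.
have [k' hk'] := step i k hi c (leqnn c); rewrite subnn in hk'.
exists (maxn k k').+1 => u Uu; apply: ucs_gen_step; first by apply: sML; case: Uu.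
move=> a [Ma | Na].
  by apply: (ucs_mono sL (leq_maxl k k')); apply: hi; case: Uu => _; apply.
apply: (ucs_mono sL (leq_maxr k k')); apply: hk'; first exact: MR.
have -> : [c u, a] = (a ^ u)^-1 * a by ceq.
by apply: sgM => //; apply: sgV => //; apply: nN.
Qed.

Lemma mulsetC M N : subset _ (mulset M N) (mulset N M).
Proof. by apply: gen_mono => y []; [right | left]. Qed.

Lemma fitting_nilpotent M N : sg M -> sg N -> normalised M (setT G) -> normalised N (setT G) ->
  nilpotent _ M -> nilpotent _ N -> nilpotent _ (mulset M N).
Proof.
move=> sM sN nM nN nilM nilN.
have [k1 h1] := fitting_half sM sN nM nN nilM nilN.
have [k2 h2] := fitting_half sN sM nN nM nilN nilM.
have eqNM : mulset N M = mulset M N by apply/funext=> x; apply/propext; split; apply: mulsetC.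
rewrite eqNM in h2; have sL : sg (mulset M N) := gen_sg _.
apply: (@nilpotent_gen_ucs _ _ (maxn k1 k2)) => x [/h1 | /h2]; apply: ucs_mono => //.
  exact: leq_maxl.
exact: leq_maxr.
Qed.

(** By Fitting's theorem, the union of the nilpotent normal subgroups is already closed under
    products. *)
Lemma mem_fitting x : fitting _ x ->
  exists N, [/\ sg N, normalised N (setT G), nilpotent _ N & N x].
Proof.
apply: (gen_min (H := fun x => exists N, [/\ sg N, normalised N (setT G), nilpotent _ N & N x])).
  split.
    exists (fun y => y = 1); split=> //; first exact: trivial_sg.
      by move=> u h _ ->; rewrite conj1g.
    by exists 0.
  split=> [u v [M [sM nM nilM Mu]] [N [sN nN nilN Nv]] | u [N [sN nN nilN Nu]]].
    exists (mulset M N); split; first exact: gen_sg.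
    - exact: mulset_normal.
    - exact: fitting_nilpotent.
    by apply: sgM (gen_sg _) _ _; apply: gen_in; [left | right].
  by exists N; split=> //; apply: sgV.
by move=> u [N [/normalP[sN nN] [nilN Nu]]]; exists N.
Qed.

Lemma center_normal : sg (center G) /\ normalised (center G) (setT G).
Proof.
split; last by move=> u h _ Zu y; have -> : u ^ h = u by apply/conj_eq_comm; apply: Zu.
split; first by move=> y; rewrite gmul1 gmulr1.
split=> [x y Zx Zy z | x Zx z]; first by rewrite gmulA Zy mulA Zx gmulA.
by apply: (@gmulI _ x); rewrite gmulK mulA Zx gmulA gmulrV gmulr1.
Qed.

Lemma center_nilpotent : nilpotent _ (center G).
Proof.
exists 1%N; apply: commsub_min trivial_sg _ => a b Za _.
by apply/comm_eq1; apply: Za.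
Qed.

Lemma center_fitting : subset _ (center G) (fitting G).
Proof.
move=> z Zz; apply: gen_in; exists (center G); split; first by apply/normalP/center_normal.
by split=> //; apply: center_nilpotent.
Qed.

(** One nilpotent normal [N] contains those of the finitely many representatives modulo the centre
    that lie in [Fit(G)]; then [Fit(G)] is contained in [N Z(G)], again nilpotent. *)
Lemma fitting_props : finite_index _ (center G) (setT G) ->
  nilpotent _ (fitting G) /\ finite_index _ (fitting G) (setT G).
Proof.
move=> [l hl]; split; last first.
  by exists l => k Tk; have [t [lt Zt]] := hl k Tk; exists t; split=> //; apply: center_fitting.
have [N [sN nN nilN hN]] : exists N, [/\ sg N, normalised N (setT G), nilpotent _ N &
    forall t, List.In t l -> fitting _ t -> N t].
  elim: l {hl} => [|t l [N [sN nN nilN hN]]].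
    have [N [sN nN nilN _]] := mem_fitting (sg1 (gen_sg _)).
    by exists N; split.
  have [Ft | nFt] := pselect (fitting _ t).
    have [M [sM nM nilM Mt]] := mem_fitting Ft.
    exists (mulset M N); split; first exact: gen_sg.
    - exact: mulset_normal.
    - exact: fitting_nilpotent.
    by move=> s [<- _ | ls Fs]; apply: gen_in; [left | right; apply: hN].
  by exists N; split=> // s [<- // | ]; apply: hN.
have [sZ nZ] := center_normal.
apply: nilpotentS (fitting_nilpotent sN sZ nN nZ nilN center_nilpotent) => x Fx.
have [t [lt Zt]] := hl x I; have -> : x = t * (t^-1 * x) by geq.
apply: sgM (gen_sg _) _ _; apply: gen_in; [left | by right].
apply: hN => //; have -> : t = x * (t^-1 * x)^-1 by geq.
have sF : sg (fitting G) := gen_sg _.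
by apply: (sgM sF Fx); apply: (sgV sF); apply: center_fitting.
Qed.

End Fitting.

(** * Homomorphisms and quotients *)

Definition is_hom (G Q : Group) (f : G -> Q) := forall x y, f (x * y)%grp = (f x * f y)%grp.

Definition img (G Q : Group) (f : G -> Q) (A : gset G) : gset Q :=
  fun q => exists2 g, A g & f g = q.

Section Hom.
Variables (G Q : Group) (f : G -> Q).
Hypothesis fM : is_hom f.
Implicit Types (x y u : G) (A B H : gset G).
Local Open Scope grp_scope.

Lemma hom1 : f 1 = 1.
Proof. by apply: (@gmulI _ (f 1)); rewrite -fM !gmulr1. Qed.
Lemma homV x : f x^-1 = (f x)^-1.
Proof. by apply: (@gmulI _ (f x)); rewrite -fM !gmulrV hom1. Qed.
Lemma homJ u x : f (u ^ x) = f u ^ f x.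
Proof. by rewrite /gconj !fM homV. Qed.
Lemma homR u x : f [c u, x] = [c f u, f x].
Proof. by rewrite /comm !fM !homV. Qed.
Lemma hom_eng u x n : f (eng u x n) = eng (f u) (f x) n.
Proof. by elim: n => //= n <-; rewrite homR. Qed.

Lemma img_sg H : sg H -> sg (img f H).
Proof.
move=> sH; split; first by exists 1; [apply: sg1 | apply: hom1].
split=> [_ _ [x Hx <-] [y Hy <-] | _ [x Hx <-]].
  by exists (x * y); rewrite ?fM //; apply: sgM.
by exists x^-1; rewrite ?homV //; apply: sgV.
Qed.

Lemma preim_sg (K : gset Q) : sg K -> sg (fun g => K (f g)).
Proof.
move=> sK; split; first by rewrite hom1; apply: sg1.
by split=> [x y Kx Ky | x Kx]; rewrite ?fM ?homV; [apply: sgM | apply: sgV].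
Qed.

Lemma img_commsub A B : subset _ (commsub _ (img f A) (img f B)) (img f (commsub _ A B)).
Proof.
apply: commsub_min (img_sg (gen_sg _)) _ => _ _ [a Aa <-] [b Bb <-].
by exists [c a, b]; [apply: commsub_in | apply: homR].
Qed.

Lemma img_lcs H n : subset _ (lcs _ (img f H) n) (img f (lcs _ H n)).
Proof.
elim: n => [|n IH] //= x cx; apply: img_commsub; move: x cx.
exact: commsub_mono.
Qed.

Lemma img_derived H n : subset _ (derived _ (img f H) n) (img f (derived _ H n)).
Proof.
elim: n => [|n IH] //= x cx; apply: img_commsub; move: x cx.
exact: commsub_mono.
Qed.

Lemma img_nilpotent H : nilpotent _ H -> nilpotent _ (img f H).
Proof. by case=> n tn; exists n => _ /img_lcs[g /tn-> <-]; apply: hom1. Qed.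

Hypothesis f_surj : forall q, exists g, f g = q.

Lemma img_preim (K : gset Q) : img f (fun g => K (f g)) = K.
Proof.
apply/funext=> q; apply/propext; split=> [[g Kg <-] // | Kq].
by have [g e] := f_surj q; exists g; rewrite ?e.
Qed.

Lemma img_setT : img f (setT G) = setT Q.
Proof. by apply/funext=> q; apply/propext; split=> // _; have [g e] := f_surj q; exists g. Qed.

Lemma mnh_preim_normal (K : gset Q) : meta_nil_hamiltonian G -> sg K -> ~ nilpotent _ K ->
  normalised K (setT Q).
Proof.
move=> mnh sK nK.
have [||_ nP] := (normalP _).1 (mnh (fun g => K (f g)) _ _); first exact: preim_sg.
  by move=> /img_nilpotent; rewrite img_preim.
move=> u h _ Ku; have [x ex] := f_surj u; have [y ey] := f_surj h.
by rewrite -ex -ey -homJ; apply: nP => //; rewrite ex.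
Qed.

Lemma mnh_hom : meta_nil_hamiltonian G -> meta_nil_hamiltonian Q.
Proof. by move=> mnh K sK nK; apply/normalP; split=> //; apply: mnh_preim_normal. Qed.

Lemma finitely_generated_hom : finitely_generated G -> finitely_generated Q.
Proof.
move=> [l hl]; exists (List.map f l) => q; have [g <-] := f_surj q.
apply: (hl g _ (preim_sg (gen_sg _))) => a la.
by apply: gen_in; apply: List.in_map.
Qed.

End Hom.

Section Quotient.
Variables (G : Group) (N : gset G).
Hypotheses (sN : sg N) (nN : normalised N (setT G)).
Implicit Types (x y u : G).
Local Open Scope grp_scope.

Let coset x : gset G := fun z => N (x^-1 * z).
Let cosets := {S : gset G | exists x, S = coset x}.
Let proj x : cosets := exist _ (coset x) (ex_intro _ x erefl).

Let projP x y : proj x = proj y <-> N (x^-1 * y).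
Proof.
split=> [[e] | Nxy].
  have : coset y y by rewrite /coset gmulV; apply: sg1.
  by rewrite -e.
suff e : coset x = coset y by apply: eq_exist.
apply/funext=> z; apply/propext; split; rewrite /coset => Nz.
  have -> : y^-1 * z = (x^-1 * y)^-1 * (x^-1 * z) by geq.
  by apply: sgM => //; apply: sgV.
have -> : x^-1 * z = (x^-1 * y) * (y^-1 * z) by geq.
exact: sgM.
Qed.

Let rep_ex (q : cosets) : exists x, proj x = q.
Proof. by case: q => S [x e]; exists x; rewrite /proj; apply: eq_exist. Qed.
Let rep q := projT1 (cid (rep_ex q)).
Let repK q : proj (rep q) = q. Proof. exact: projT2 (cid (rep_ex q)). Qed.

Let qmul q r := proj (rep q * rep r).
Let qmulE x y : qmul (proj x) (proj y) = proj (x * y).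
Proof.
have /projP Nx := repK (proj x); have /projP Ny := repK (proj y).
apply/projP; have -> : (rep (proj x) * rep (proj y))^-1 * (x * y) =
  ((rep (proj x))^-1 * x) ^ (rep (proj y)) * ((rep (proj y))^-1 * y) by ceq.
by apply: sgM => //; apply: nN.
Qed.

(** Cosets are predicates, equal as soon as they have the same members, and products are taken on
    chosen representatives. *)
Lemma exists_quotient : exists (Q : Group) (f : G -> Q),
  [/\ is_hom f, forall q, exists g, f g = q & forall g, f g = 1 <-> N g].
Proof.
pose qinv q := proj (rep q)^-1.
have A q r s : qmul q (qmul r s) = qmul (qmul q r) s.
  by rewrite -(repK q) -(repK r) -(repK s) !qmulE mulA.
have one_q q : qmul (proj 1) q = q by rewrite -(repK q) qmulE gmul1.
have inv_q q : qmul (qinv q) q = proj 1.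
  by rewrite -{2}(repK q) /qinv qmulE gmulV.
exists (@Build_Group cosets qmul qinv (proj 1) A one_q inv_q), proj; split=> [x y | q | g] /=.
- by rewrite qmulE.
- by have [x <-] := rep_ex q; exists x.
split=> [/esym/projP | Ng]; first by rewrite ginv1 gmul1.
by apply/esym/projP; rewrite ginv1 gmul1.
Qed.

End Quotient.

(** * Powers and finiteness *)

Section Powers.
Variable G : Group.
Implicit Types (x y u : G) (m n : nat).
Local Open Scope grp_scope.

Lemma gpowS x n : gpow _ x n.+1 = x * gpow _ x n. Proof. by []. Qed.

Lemma gpowD x m n : gpow _ x (m + n) = gpow _ x m * gpow _ x n.
Proof. by elim: m => [|m IH]; rewrite ?gmul1 // addSn !gpowS IH gmulA. Qed.

Lemma gpow_1 n : gpow G 1 n = 1.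
Proof. by elim: n => //= n ->; rewrite gmul1. Qed.

Lemma gpow1 x : gpow _ x 1 = x. Proof. exact: gmulr1. Qed.

Lemma gpowM x m n : gpow _ x (m * n) = gpow _ (gpow _ x m) n.
Proof. by elim: n => [|n IH]; rewrite ?muln0 // mulnS gpowD IH. Qed.

Lemma gpow_sg (H : gset G) x n : sg H -> H x -> H (gpow _ x n).
Proof. by move=> sH Hx; elim: n => [|n IH]; [apply: sg1 | apply: sgM]. Qed.

Lemma gpow_conj x u n : gpow _ u n ^ x = gpow _ (u ^ x) n.
Proof. by elim: n => [|n IH]; rewrite ?conj1g // !gpowS conjM IH. Qed.

Lemma gpow_comm x y n : x * y = y * x -> gpow _ x n * y = y * gpow _ x n.
Proof.
move=> e; elim: n => [|n IH]; first by geq.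
by rewrite gpowS gmulA IH -gmulA e gmulA.
Qed.

Definition zpow x (z : int) : G :=
  match z with Posz n => gpow _ x n | Negz n => (gpow _ x n.+1)^-1 end.

(** Exponents written as differences of naturals avoid a case analysis on signs in [zpowD]. *)
Lemma zpowE x m n : zpow x (m%:Z - n%:Z)%R = gpow _ x m * (gpow _ x n)^-1.
Proof.
have [le_nm | lt_mn] := leqP n m.
  by rewrite subzn //= -{2}(subnK le_nm) gpowD; geq.
rewrite -GRing.opprB subzn ?(ltnW lt_mn) //.
have [k ek] : exists k, (n - m = k.+1)%N by exists (n - m).-1; rewrite prednK // subn_gt0.
by rewrite ek -NegzE /= -[x * _]/(gpow _ x k.+1) -ek -{2}(subnK (ltnW lt_mn)) gpowD; geq.
Qed.

Lemma int_diff (z : int) : exists m n : nat, z = (m%:Z - n%:Z)%R.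
Proof.
case: z => n; first by exists n, 0; rewrite GRing.subr0.
by exists 0, n.+1; rewrite NegzE GRing.sub0r.
Qed.

Lemma gpow_commg x m n : gpow _ x m * gpow _ x n = gpow _ x n * gpow _ x m.
Proof. by rewrite -!gpowD addnC. Qed.

Lemma gpow_commV x m n : gpow _ x m * (gpow _ x n)^-1 = (gpow _ x n)^-1 * gpow _ x m.
Proof. by apply: (@gmulI _ (gpow _ x n)); rewrite -!gmulA gpow_commg; geq. Qed.

Lemma zpowD x (a b : int) : zpow x (a + b)%R = zpow x a * zpow x b.
Proof.
have [m [n ->]] := int_diff a; have [m' [n' ->]] := int_diff b.
have -> : (m%:Z - n%:Z + (m'%:Z - n'%:Z) = (m + m')%:Z - (n' + n)%:Z)%R.
  by rewrite !PoszD GRing.opprD GRing.addrACA [(- n%:Z - _)%R]GRing.addrC.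
by rewrite !zpowE !gpowD ginvM !gmulA; congr (_ * _); rewrite -!gmulA gpow_commV.
Qed.

Lemma zpow1 x : zpow x 1 = x. Proof. exact: gmulr1. Qed.

Lemma zpowN x (a : int) : zpow x (- a)%R = (zpow x a)^-1.
Proof. by apply: (@gmulI _ (zpow x a)); rewrite -zpowD GRing.subrr gmulrV. Qed.

Lemma zpow_sg (H : gset G) x (a : int) : sg H -> H x -> H (zpow x a).
Proof. by move=> sH Hx; case: a => n; [|apply: (sgV sH)]; apply: gpow_sg. Qed.

Lemma zpow_conj x u (a : int) : zpow u a ^ x = zpow (u ^ x) a.
Proof. by case: a => n; rewrite /zpow ?conjV gpow_conj. Qed.

Lemma zpowMn x (a : int) n : zpow x (a * n%:Z)%R = gpow _ (zpow x a) n.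
Proof. by elim: n => [|n IH]; rewrite ?GRing.mulr0 // -add1n PoszD GRing.mulrDr GRing.mulr1 zpowD IH. Qed.

Lemma zpowM x (a b : int) : zpow x (a * b)%R = zpow (zpow x a) b.
Proof.
case: b => n; first exact: zpowMn.
by rewrite NegzE GRing.mulrN !zpowN zpowMn.
Qed.

Lemma zpow_inf x (a : int) : (forall k, 0 < k -> gpow _ x k <> 1) -> zpow x a = 1 -> a = 0%R.
Proof.
move=> inf; case: a => [[|n] | n] // e; first by case: (inf n.+1).
have {}e : (gpow _ x n.+1)^-1 = 1 := e.
by case: (inf n.+1) => //; rewrite -[LHS]ginvK e ginv1.
Qed.

Lemma zpow_comm x y (a : int) : x * y = y * x -> zpow x a * y = y * zpow x a.
Proof.
move=> e; case: a => n; first exact: gpow_comm.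
by apply: (@gmulI _ (gpow _ x n.+1)); rewrite gmulK -gmulA (gpow_comm n.+1 e); geq.
Qed.

Lemma gen_cycle x z : gen (fun y => y = x) z -> exists a : int, z = zpow x a.
Proof.
apply: (gen_min (H := fun z => exists a : int, z = zpow x a)) => [|y ->]; last by exists 1%R; rewrite zpow1.
split; first by exists 0%R.
split=> [_ _ [a ->] [b ->] | _ [a ->]]; first by exists (a + b)%R; rewrite zpowD.
by exists (- a)%R; rewrite zpowN.
Qed.

Lemma gen_cycle_ext (F : gset G) x z : sg F ->
  (forall u, F u -> F (u ^ x) /\ F (u ^ x^-1)) ->
  gen (fun y => y = x \/ F y) z -> exists f (a : int), F f /\ z = f * zpow x a.
Proof.
move=> sF nF.
have nFx (a : int) u : F u -> F (u ^ (zpow x a)^-1).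
  apply: (normalised_gen (A := fun y => y = x) sF); last first.
    apply: (sgV (gen_sg _)); apply: zpow_sg (gen_sg _) _; exact: gen_in.
  by move=> v _ ->; apply: nF.
apply: (gen_min (H := fun z => exists f (a : int), F f /\ z = f * zpow x a)) => [|y [-> | Fy]]; last 2 first.
- by exists 1, 1%R; rewrite zpow1 gmul1; split=> //; apply: sg1.
- by exists y, 0%R; rewrite gmulr1.
split; first by exists 1, 0%R; rewrite gmul1; split=> //; apply: sg1.
split=> [_ _ [f [a [Ff ->]]] [g [b [Fg ->]]] | _ [f [a [Ff ->]]]].
  exists (f * g ^ (zpow x a)^-1), (a + b)%R; rewrite zpowD; split; last by ceq.
  by apply: (sgM sF) => //; apply: nFx.
exists (f^-1 ^ (zpow x (- a)%R)^-1), (- a)%R; split; last by rewrite zpowN; ceq.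
by apply: nFx; apply: (sgV sF).
Qed.

Lemma list_pigeonhole T (l : list T) (c : nat -> T) : (forall n, List.In (c n) l) ->
  exists i j, i < j /\ c i = c j.
Proof.
move=> hc; have hch n : exists i : 'I_(length l), List.nth i l (c 0) = c n.
  by have [i [/ltP lt_i e]] := List.In_nth _ _ (c 0) (hc n); exists (Ordinal lt_i).
have [d dP] := choice hch; apply: contrapT => inj.
have : injective (fun i : 'I_(length l).+1 => d i).
  have key (i j : 'I_(length l).+1) : d i = d j -> i < j -> False.
    by move=> e lt; apply: inj; exists i, j; split; rewrite // -(dP j) -e dP.
  by move=> i j e; case: (ltngtP i j) => [/(key i j e) | /(key j i (esym e)) | /val_inj].
by move/leq_card; rewrite !card_ord ltnn.
Qed.

Lemma pigeonhole_pow (A K : gset G) x : sg A -> sg K -> finite_index _ A K -> K x ->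
  exists2 m, 0 < m & A (gpow _ x m).
Proof.
move=> sA sK [l hl] Kx.
have [c cP] := choice (fun n => hl _ (gpow_sg n sK Kx)).
have [i [j [lt_ij eij]]] : exists i j, i < j /\ c i = c j.
  by apply: (list_pigeonhole (l := l)) => n; case: (cP n).
exists (j - i); first by rewrite subn_gt0.
have [_ Pi] := cP i; have [_ Pj] := cP j.
rewrite -eij -(subnKC (ltnW lt_ij)) gpowD in Pj.
have -> : gpow _ x (j - i) = ((c i)^-1 * gpow _ x i)^-1 * ((c i)^-1 * (gpow _ x i * gpow _ x (j - i))) by geq.
by apply: sgM => //; apply: sgV.
Qed.

End Powers.

(** * Finite sets, transversals and torsion abelian groups *)

Section Finiteness.
Variable G : Group.
Implicit Types (x y u : G) (A H K : gset G) (l : list G).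
Local Open Scope grp_scope.

Lemma In_mem (T : eqType) (x : T) (s : seq T) : List.In x s <-> x \in s.
Proof.
elim: s => //= a s IH; rewrite in_cons; split.
  by case=> [-> | /IH->]; rewrite ?eqxx ?orbT.
by case/orP=> [/eqP-> | /IH]; [left | right].
Qed.

Lemma finite_range (J : finType) T (f : J -> T) :
  exists l : list T, (forall j, List.In (f j) l) /\ (forall t, List.In t l -> exists j, t = f j).
Proof.
exists (List.map f (enum J)); split.
  by move=> j; apply: List.in_map; apply/In_mem; rewrite mem_enum.
by move=> t /List.in_map_iff[j [<- _]]; exists j.
Qed.

(** The list in [finite_index] may repeat cosets or use representatives outside [K]; a covering of
    [K] of minimal length by elements of [K] does neither. [A] need not lie in [K]. The size [m.+1]
    provides the default index [ord0] for arguments outside [K]. *)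
Lemma transversal A K : sg A -> K 1 -> finite_index _ A K ->
  exists m (r : 'I_m.+1 -> G) (ix : G -> 'I_m.+1), [/\ forall i, K (r i),
    forall g, K g -> A ((r (ix g))^-1 * g) &
    forall g i, K g -> A ((r i)^-1 * g) -> i = ix g].
Proof.
move=> sA K1 [l hl].
pose cover n := exists r : 'I_n -> G,
  (forall i, K (r i)) /\ (forall g, K g -> exists i, A ((r i)^-1 * g)).
have exc : exists n, `[< cover n >].
  exists (length l); apply/asboolP.
  have hch (i : 'I_(length l)) : exists s, K s /\ (forall g, K g -> A ((List.nth i l 1)^-1 * g) -> A (s^-1 * g)).
    have [[s [Ks As]] | no] := pselect (exists s, K s /\ A ((List.nth i l 1)^-1 * s)).
      exists s; split=> // g Kg Ag.
      have -> : s^-1 * g = ((List.nth i l 1)^-1 * s)^-1 * ((List.nth i l 1)^-1 * g) by geq.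
      by apply: sgM => //; apply: sgV.
    by exists 1; split=> // g Kg Ag; case: no; exists g.
  have [r hr] := choice hch; exists r; split=> [i | g Kg]; first by case: (hr i).
  have [t [lt At]] := hl g Kg; have [i [/ltP lt_i e]] := List.In_nth _ _ 1 lt.
  by exists (Ordinal lt_i); case: (hr (Ordinal lt_i)) => _; apply=> //=; rewrite e.
case: (ex_minnP exc) => [[|m]] /asboolP[r [Kr hr]] minm; first by have [[]] := hr 1 K1.
have uniq_r g i j : A ((r i)^-1 * g) -> A ((r j)^-1 * g) -> i = j.
  move=> Ai Aj; apply/eqP/negPn/negP => neq_ij.
  suff /minm : `[< cover m >] by rewrite ltnn.
  apply/asboolP; exists (fun k => r (lift i k)); split=> [k | h Kh]; first exact: Kr.
  have [k Ak] := hr h Kh; have [ek | nk] := eqVneq i k; last first.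
    by have [k' e' _] := unlift_some nk; exists k'; rewrite -e'.
  have [k' e' _] := unlift_some neq_ij; exists k'; rewrite -e'.
  have -> : (r j)^-1 * h = ((r j)^-1 * g) * ((r i)^-1 * g)^-1 * ((r i)^-1 * h) by geq.
  rewrite -ek in Ak; apply: (sgM sA _ Ak); apply: (sgM sA) => //; exact: (sgV sA).
have hch g : exists i, K g -> A ((r i)^-1 * g).
  have [Kg | nKg] := pselect (K g); last by exists ord0.
  by have [i Ai] := hr g Kg; exists i.
have [ix hix] := choice hch.
exists m, r, ix; split=> // g i Kg Ai; exact: uniq_r Ai (hix g Kg).
Qed.

Lemma torsion_abelian_finite l :
  (forall u v, elts l u -> elts l v -> u * v = v * u) ->
  (forall u, elts l u -> exists2 k, 0 < k & gpow _ u k = 1) ->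
  finite_set _ (gen (elts l)).
Proof.
elim: l => [|a l IH] com tor.
  by exists (1 :: nil)%SEQ => x gx; left; symmetry; move: x gx; apply: gen_min trivial_sg _.
have [||s hs] := IH.
- by move=> u v lu lv; apply: com; right.
- by move=> u lu; apply: tor; right.
have [|k k_gt0 ak] := tor a; first by left.
have comA w : gen (elts l) w -> a * w = w * a.
  move=> gw; apply/conj_eq_comm; apply/conj_eq_comm; apply/comm_eq1.
  apply: (comm_gen_r (N := fun y => y = 1)) gw; first exact: trivial_sg.
    by move=> u h _ ->; rewrite conj1g.
  by move=> u lu; apply/comm_eq1; apply: com; [left | right].
have sl := gen_sg (elts l).
pose S z := exists n w, gen (elts l) w /\ z = gpow _ a n * w.
have sS : sg S.
  split; first by exists 0, 1; split; [apply: sg1 sl | rewrite gmul1].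
  split=> [_ _ [m [w [gw ->]]] [n [w' [gw' ->]]] | _ [n [w [gw ->]]]].
    exists (m + n), (w * w'); split; first exact: (sgM sl).
    rewrite gpowD !gmulA; congr (_ * _); rewrite -!gmulA; congr (_ * _).
    by rewrite gpow_comm // comA.
  (* As [a^k = 1], the exponent [n (k - 1)] stands for [-n]. *)
  exists (n * k.-1)%N, w^-1; split; first exact: (sgV sl).
  have -> : gpow _ a (n * k.-1) = (gpow _ a n)^-1.
    apply: (@gmulI _ (gpow _ a n)); rewrite gmulrV -gpowD.
    by rewrite -mulnS prednK // mulnC gpowM ak gpow_1.
  rewrite -ginvM -gpow_comm //; exact: comA.
exists (List.flat_map (fun w => List.map (fun n => gpow _ a n * w) (iota 0 k)) s) => z gz.
have [n [w [gw ->]]] : S z.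
  apply: gz => // u [<- | lu].
    by exists 1%N, 1; split; [apply: sg1 sl | rewrite gpow1 gmulr1].
  by exists 0, u; split; [apply: gen_in | rewrite gmul1].
apply/List.in_flat_map; exists w; split; first exact: hs.
apply/List.in_map_iff; exists (n %% k); split.
  by rewrite {2}(divn_eq n k) gpowD mulnC gpowM ak gpow_1 gmul1.
by apply/In_mem; rewrite mem_iota add0n ltn_mod.
Qed.

End Finiteness.

(** * Abelian subgroups as Z-modules *)

Record ab_sub (G : Group) := AbSub {
  ab_set :> G -> Prop;
  ab_sg : is_subgroup G ab_set;
  ab_comm : forall x y : G, ab_set x -> ab_set y -> mul G x y = mul G y x }.

Definition ab_elt (G : Group) (A : ab_sub G) := {g : G | A g}.

Section AbelianZmodule.
Variables (G : Group) (A : ab_sub G).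
Local Open Scope grp_scope.
Implicit Types u v w : ab_elt A.

Definition ab_add u v : ab_elt A := exist _ _ (sgM (ab_sg A) (proj2_sig u) (proj2_sig v)).
Definition ab_opp u : ab_elt A := exist _ _ (sgV (ab_sg A) (proj2_sig u)).
Definition ab_zero : ab_elt A := exist _ _ (sg1 (ab_sg A)).

Lemma ab_addA : associative ab_add.
Proof. by move=> u v w; apply: eq_exist; rewrite /= mulA. Qed.
Lemma ab_addC : commutative ab_add.
Proof. by move=> [u Au] [v Av]; apply: eq_exist; apply: (ab_comm Au Av). Qed.
Lemma ab_add0 : left_id ab_zero ab_add.
Proof. by move=> [u Au]; apply: eq_exist; rewrite /= gmul1. Qed.
Lemma ab_addN : left_inverse ab_zero ab_opp ab_add.
Proof. by move=> u; apply: eq_exist; rewrite /= gmulV. Qed.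

HB.instance Definition _ := gen_eqMixin (ab_elt A).
HB.instance Definition _ := gen_choiceMixin (ab_elt A).
HB.instance Definition _ := GRing.isZmodule.Build (ab_elt A) ab_addA ab_addC ab_add0 ab_addN.

End AbelianZmodule.

(** * A finite subgroup with a non-Engel action *)

(** An inclusion is enough: [F] being finite, conjugation by [x] permutes it. *)
Definition finite_nonengel (G : Group) (x : G) := exists F : gset G,
  [/\ sg F, finite_set _ F, forall u, F u -> F (u ^ x)%grp &
      exists2 u, F u & forall n, eng u x n <> (1)%grp].

Section AbelianConj.
Variables (G : Group) (A : ab_sub G).
Hypothesis nA : normalised A (setT G).
Local Open Scope grp_scope.

Definition ab_conj (x : G) (u : ab_elt A) : ab_elt A :=
  exist _ (sval u ^ x) (nA I (proj2_sig u)).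

Local Open Scope ring_scope.

Lemma ab_conjD x u v : ab_conj x (u + v) = ab_conj x u + ab_conj x v.
Proof. by apply: eq_exist; rewrite /= conjM. Qed.

Lemma ab_conjK x : cancel (ab_conj x) (ab_conj (inv _ x)).
Proof. by move=> [u Au]; apply: eq_exist; rewrite /= conjK. Qed.

Lemma ab_conjKV x : cancel (ab_conj (inv _ x)) (ab_conj x).
Proof. by move=> [u Au]; apply: eq_exist; rewrite /= conjKV. Qed.

Lemma val_sub1 x u : sval (phi_sub1 (ab_conj x) u) = [c sval u, x]%grp.
Proof.
case: u => u Au /=; rewrite comm_conj; apply: (@ab_comm _ A); first exact: nA.
exact: (sgV (ab_sg A)).
Qed.

Lemma val_iter_sub1 x u n : sval (iter n (phi_sub1 (ab_conj x)) u) = eng (sval u) x n.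
Proof. by elim: n => // n IH; rewrite iterS val_sub1 IH. Qed.

Lemma ab_eq0 (u : ab_elt A) : u = 0 <-> sval u = (1)%grp.
Proof. by split=> [-> // | e]; case: u e => u Au /= e; apply: eq_exist. Qed.

Lemma val_mulrn (u : ab_elt A) n : sval (u *+ n) = gpow _ (sval u) n.
Proof. by elim: n => // n IH; rewrite GRing.mulrS /= IH. Qed.

End AbelianConj.

Section NonEngelAbelian.
Variables (G : Group) (A : ab_sub G) (x : G).
Hypothesis mnh : meta_nil_hamiltonian G.
Hypothesis nA : normalised A (setT G).
Local Open Scope grp_scope.

Lemma nilpotent_engel (K : gset G) : sg K -> K x -> nilpotent _ K ->
  exists n, forall u, K u -> eng u x n = 1.
Proof.
move=> sK Kx /(nilpotent_ucs sK)[n hn]; exists n => u Ku.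
suff h i : i <= n -> ucs K (n - i) (eng u x i) by have := h n (leqnn n); rewrite subnn.
elim: i => [|i IH] lt_in; first by rewrite subn0; apply: hn.
by have := IH (ltnW lt_in); rewrite -(subnSK lt_in) => -[_]; apply.
Qed.

Lemma ab_stable_dichotomy (B : ab_elt A -> Prop) :
  B 0%R -> (forall u v, B u -> B v -> B (u - v)%R) ->
  (forall u, B u -> B (ab_conj nA x u)) -> (forall u, B u -> B (ab_conj nA x^-1 u)) ->
  (exists n, forall b, B b -> iter n (phi_sub1 (ab_conj nA x)) b = 0%R) \/
  (forall u, exists2 b, B b &
     phi_sub1 (ab_conj nA x) (phi_sub1 (ab_conj nA x) u) = phi_sub1 (ab_conj nA x) b).
Proof.
move=> B0 BB Bx BxV; pose B' : gset G := fun g => exists2 b, B b & sval b = g.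
have BN b : B b -> B (- b)%R by move=> Bb; rewrite -GRing.sub0r; apply: BB.
have sB' : sg B'.
  split; first by exists 0%R.
  split=> [_ _ [b Bb <-] [b' Bb' <-] | _ [b Bb <-]]; last by exists (- b)%R; rewrite //; apply: BN.
  by exists (b + b')%R; rewrite // -[b']GRing.opprK; apply: BB => //; apply: BN.
have sB'A g : B' g -> A g by case=> [[u Au] _ <-].
set K := gen (fun y => y = x \/ B' y); have sK : sg K := gen_sg _.
have Kx : K x by apply: gen_in; left.
have [nilK | nnK] := pselect (nilpotent _ K).
  have [n hn] := nilpotent_engel sK Kx nilK; left; exists n => b Bb.
  by apply/ab_eq0; rewrite val_iter_sub1; apply: hn; apply: gen_in; right; exists b.
right=> u; have [_ nK] := (normalP _).1 (mnh sK nnK).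
(* [C] is a subgroup containing [x] and normalising [B'], so [<B', x>] is contained in the product
   [B' C]. *)
pose C c := c * x = x * c /\ forall b, B' b -> B' (b ^ c) /\ B' (b ^ c^-1).
pose S z := exists b c, [/\ B' b, C c & z = b * c].
(* [[u, x]] lies in [<B', x>], and the part of it outside [B'] commutes with [x]. *)
have KP : subset _ K S.
  have Cx : C x.
    split=> // _ [b Bb <-]; split; first by exists (ab_conj nA x b) => //; apply: Bx.
    by exists (ab_conj nA x^-1 b) => //; apply: BxV.
  have C1 : C 1 by split=> [|b B'b]; [geq | rewrite ginv1 !conjg1].
  have CM c d : C c -> C d -> C (c * d).
    move=> [ec hc] [ed hd]; split; first by rewrite gmulA ed -gmulA ec gmulA.
    move=> b B'b; rewrite ginvM !conjJM; split; first by case: (hc b B'b) => /hd[].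
    by case: (hd b B'b) => _ /hc[].
  have CV c : C c -> C c^-1.
    move=> [ec hc]; split; last by move=> b /hc[]; rewrite ginvK.
    by apply: (@gmulI _ c); rewrite gmulK -[in RHS]gmulA ec gmulA gmulrV gmulr1.
  apply: gen_min => [|y [-> | B'y]]; last 2 first.
  - by exists 1, x; split=> //; [apply: sg1 | geq].
  - by exists y, 1; split=> //; geq.
  split; first by exists 1, 1; split=> //; [apply: sg1 | geq].
  split=> [_ _ [b [c [Bb Cc ->]]] [b' [c' [Bb' Cc' ->]]] | _ [b [c [Bb Cc ->]]]].
    exists (b * b' ^ c^-1), (c * c'); split; last by ceq.
      by apply: (sgM sB') => //; case: Cc => _ /(_ b' Bb')[].
    exact: CM.
  exists (b^-1 ^ c), c^-1; split; [| exact: CV | by ceq].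
  by case: Cc => _ /(_ _ (sgV sB' Bb))[].
have Kux : K [c sval u, x].
  have -> : [c sval u, x] = (x^-1) ^ sval u * x by ceq.
  by apply: (sgM sK) => //; apply: nK => //; apply: (sgV sK).
have [b [c [[b0 Bb0 eb] [Cx _] e]]] := KP _ Kux.
have Ab : A b by rewrite -eb; case: (b0).
have Auu : A [c sval u, x] by rewrite -val_sub1; case: (phi_sub1 _ _).
(* Since [c] lies in the abelian [A], conjugating [[b, x]] by it has no effect. *)
have Ac : A c by apply: (sgMl (ab_sg A) Ab); rewrite -e.
exists b0 => //.
have H : sval (phi_sub1 (ab_conj nA x) (phi_sub1 (ab_conj nA x) u)) = sval (phi_sub1 (ab_conj nA x) b0).
  rewrite !val_sub1 eb e commMl (_ : [c c, x] = 1); last by apply/comm_eq1.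
  rewrite gmulr1; apply/conj_eq_comm; apply: (@ab_comm _ A) => //.
  by rewrite -eb -val_sub1; case: (phi_sub1 _ _).
by apply: eq_sig_hprop H => ?; apply: Prop_irrelevance.
Qed.

Lemma nonengel_abelian a : A a -> (forall n, eng a x n <> 1) -> finite_nonengel x.
Proof.
move=> Aa hne; pose a0 : ab_elt A := exist _ a Aa.
have [n|S [F [FS [F0 FB] Fx [u Fu hu]]]] := finite_submodule (ab_conjD nA x) (ab_conjK nA x)
  (ab_conjKV nA x) ab_stable_dichotomy (v0 := a0).
  by move/ab_eq0; rewrite val_iter_sub1; apply: hne.
exists (fun g => exists2 b, F b & sval b = g); split.
- split; first by exists 0%R.
  have FN b : F b -> F (- b)%R by move=> Fb; rewrite -GRing.sub0r; apply: FB.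
  split=> [_ _ [b Fb <-] [b' Fb' <-] | _ [b Fb <-]]; last by exists (- b)%R; rewrite //; apply: FN.
  by exists (b + b')%R; rewrite // -[b']GRing.opprK; apply: FB => //; apply: FN.
- exists (List.map (fun b : ab_elt A => sval b) S) => _ [b Fb <-].
  by apply: (List.in_map (fun b : ab_elt A => sval b)); apply: FS.
- by move=> _ [b Fb <-]; exists (ab_conj nA x b); rewrite //; apply: Fx.
exists (sval u); first by exists u.
by move=> n en; apply: (hu n); apply/ab_eq0; rewrite val_iter_sub1.
Qed.

End NonEngelAbelian.

(** * The transfer into an abelian normal subgroup *)

Section Transfer.
Variables (G : Group) (A : ab_sub G).
Hypothesis nA : normalised A (setT G).
Variable E : gset G.
Hypotheses (sE : sg E) (sAE : forall g, A g -> E g).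
Variables (m : nat) (r : 'I_m.+1 -> G) (ix : G -> 'I_m.+1).
Hypothesis rE : forall i, E (r i).
Hypothesis ixP : forall g, E g -> A (mul _ (inv _ (r (ix g))) g).
Hypothesis ixU : forall g i, E g -> A (mul _ (inv _ (r i)) g) -> i = ix g.
Local Open Scope grp_scope.

Lemma coset_swap g t : A (t^-1 * g) <-> A (g * t^-1).
Proof.
have -> : g * t^-1 = (t^-1 * g) ^ t^-1 by ceq.
by split=> [|/(nA (h := t) I)]; [apply: nA | rewrite conjKV].
Qed.

(** The value 0 outside [A] is only a default: [tcoef i g] lies in [A] for every [g] in [E]. *)
Definition to_ab (g : G) : ab_elt A :=
  if pselect (A g) is left p then exist _ g p else 0%R.

Lemma to_abK g : A g -> sval (to_ab g) = g.
Proof. by rewrite /to_ab; case: pselect. Qed.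

Lemma to_abM g h : A g -> A h -> to_ab (g * h) = (to_ab g + to_ab h)%R.
Proof.
move=> Ag Ah; have H : sval (to_ab (g * h)) = sval (to_ab g + to_ab h)%R.
  by rewrite [RHS]/= !to_abK //; apply: (sgM (ab_sg A)).
by apply: eq_sig_hprop H => ?; apply: Prop_irrelevance.
Qed.

Lemma to_abV g : A g -> to_ab g^-1 = (- to_ab g)%R.
Proof.
move=> Ag; have H : sval (to_ab g^-1) = sval (- to_ab g)%R.
  by rewrite [RHS]/= !to_abK //; apply: (sgV (ab_sg A)).
by apply: eq_sig_hprop H => ?; apply: Prop_irrelevance.
Qed.

Lemma to_abJ g x : A g -> to_ab (g ^ x) = ab_conj nA x (to_ab g).
Proof.
move=> Ag; have H : sval (to_ab (g ^ x)) = sval (ab_conj nA x (to_ab g)).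
  by rewrite [RHS]/= !to_abK //; apply: nA.
by apply: eq_sig_hprop H => ?; apply: Prop_irrelevance.
Qed.

(** The factor in [r i * g = tcoef i g * r j] with [j = ix (r i * g)]. This uses right cosets and
    [ix] left ones; they agree by normality of [A], see [coset_swap]. *)
Definition tcoef i g := r i * g * (r (ix (r i * g)))^-1.
Definition transfer g : ab_elt A := (\sum_i to_ab (tcoef i g))%R.

Lemma tcoefA i g : E g -> A (tcoef i g).
Proof. by move=> Eg; apply/coset_swap; apply: ixP; apply: (sgM sE). Qed.

Lemma ix_r i : ix (r i) = i.
Proof. by apply/esym/ixU; rewrite ?gmulV //; apply: sg1 (ab_sg A). Qed.

Lemma ixU' g i : E g -> A (g * (r i)^-1) -> ix g = i.
Proof. by move=> Eg /coset_swap/(ixU Eg). Qed.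

Lemma ix_inj g : E g -> injective (fun i => ix (r i * g)).
Proof.
move=> Eg i j e; rewrite -[LHS]ix_r; apply: ixU' => //.
have -> : r i * (r j)^-1 = tcoef i g * (tcoef j g)^-1 by rewrite /tcoef e; geq.
apply: (sgM (ab_sg A)); [|apply: (sgV (ab_sg A))]; exact: tcoefA.
Qed.

Lemma tcoefM i g h : E g -> E h ->
  tcoef i (g * h) = tcoef i g * tcoef (ix (r i * g)) h.
Proof.
move=> Eg Eh; set k := ix (r i * g); set l := ix (r k * h).
have e : r i * (g * h) * (r l)^-1 = tcoef i g * tcoef k h.
  by rewrite /tcoef -/k -/l; geq.
rewrite {1}/tcoef (ixU' (i := l)) // ?e.
  by apply: (sgM sE) => //; apply: (sgM sE).
by apply: (sgM (ab_sg A)); apply: tcoefA.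
Qed.

Lemma transferM g h : E g -> E h -> transfer (g * h) = (transfer g + transfer h)%R.
Proof.
move=> Eg Eh; rewrite /transfer [X in (_ + X)%R](reindex_inj (ix_inj Eg)) /= -big_split /=.
by apply: eq_bigr => i _; rewrite tcoefM // to_abM //; apply: tcoefA.
Qed.

Lemma transfer1 : transfer 1 = 0%R.
Proof.
have E1 := sg1 sE; apply: (@GRing.addrI _ (transfer 1)).
by rewrite -transferM // gmul1 GRing.addr0.
Qed.

Lemma transferV g : E g -> transfer g^-1 = (- transfer g)%R.
Proof.
move=> Eg; apply: (@GRing.addrI _ (transfer g)).
by rewrite -transferM ?gmulrV ?transfer1 ?GRing.subrr //; apply: (sgV sE).
Qed.

(** On [A] the transfer is the norm of the action of [E / A], because [r i * a] stays in the coset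
    of [r i]. *)
Lemma transfer_ab a : A a -> transfer a = (\sum_i ab_conj nA (r i)^-1%grp (to_ab a))%R.
Proof.
move=> Aa; apply: eq_bigr => i _; rewrite -to_abJ //; congr to_ab.
have Ai : A (r i * a * (r i)^-1).
  have -> : r i * a * (r i)^-1 = a ^ (r i)^-1 by ceq.
  exact: nA.
rewrite /tcoef (ixU' (i := i)) //; first by ceq.
by apply: (sgM sE) => //; apply: sAE.
Qed.

Variable x : G.
Hypothesis xE : forall g, E g -> E (g ^ x).

Lemma ix_conj_inj : injective (fun i => ix (r i ^ x)).
Proof.
move=> i j e; rewrite -[LHS]ix_r; apply: ixU' (rE i) _.
have h k : A (r k ^ x * (r (ix (r k ^ x)))^-1) by apply/coset_swap; apply: ixP; apply: xE.
have Aij : A ((r i * (r j)^-1) ^ x).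
  have -> : (r i * (r j)^-1) ^ x = (r i ^ x * (r (ix (r i ^ x)))^-1) * (r j ^ x * (r (ix (r j ^ x)))^-1)^-1.
    by rewrite e; ceq.
  by apply: (sgM (ab_sg A)); rewrite // ; apply: (sgV (ab_sg A)).
by rewrite -[_ * _](conjK _ x); apply: nA.
Qed.

(** The transfer does not depend on the transversal. Conjugation by [x] turns [r i] into
    [a i * r (s i)], and the corrections [a i] and [a (p i)] cancel in the sum because [p] is a
    permutation. *)
Lemma transferJ g : E g -> transfer (g ^ x) = ab_conj nA x (transfer g).
Proof.
move=> Eg; pose s i := ix (r i ^ x); pose p i := ix (r i * g).
pose a i := r i ^ x * (r (s i))^-1.
have Aa i : A (a i) by apply/coset_swap; apply: ixP; apply: xE.
have e i : r (s i) * (g ^ x) * (r (s (p i)))^-1 = (a i)^-1 * (tcoef i g) ^ x * a (p i).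
  by rewrite /a /tcoef -/(p i); ceq.
have Ac i : A ((a i)^-1 * (tcoef i g) ^ x).
  by apply: (sgM (ab_sg A)); [apply: (sgV (ab_sg A)) | apply: nA => //; apply: tcoefA].
have tc i : tcoef (s i) (g ^ x) = (a i)^-1 * (tcoef i g) ^ x * a (p i).
  rewrite -e /tcoef (ixU' (i := s (p i))) //; first by apply: (sgM sE) => //; apply: xE.
  by rewrite e; apply: (sgM (ab_sg A)).
rewrite /transfer (additive_sum (ab_conjD nA x)) (reindex_inj ix_conj_inj) /=.
under eq_bigr => i _.
  rewrite tc to_abM // to_abM //; [| exact: (sgV (ab_sg A)) | by apply: nA => //; apply: tcoefA].
  rewrite to_abV // to_abJ; [|exact: tcoefA].
  over.
have re : (\sum_i to_ab (a (p i)) = \sum_i to_ab (a i))%R.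
  by rewrite [RHS](reindex_inj (ix_inj Eg)).
rewrite !big_split /= re.
by rewrite GRing.sumrN GRing.addrAC GRing.addNr GRing.add0r.
Qed.

End Transfer.

(** * Unipotent maps of finite order *)

Section UnipotentTorsion.
Variables (V : zmodType) (phi : V -> V).
Hypothesis phiD : forall u v : V, phi (u + v)%R = (phi u + phi v)%R.
Local Notation y := (phi_sub1 phi).
Local Open Scope ring_scope.
Import GRing.Theory.

Definition torsion_elt (u : V) := exists2 k, (0 < k)%N & u *+ k = 0.

Lemma additiveMn u k : phi (u *+ k) = phi u *+ k.
Proof. exact: additiveMz phiD u k%:Z. Qed.

Lemma sub1Mn u k : y (u *+ k) = y u *+ k.
Proof. by rewrite /phi_sub1 additiveMn mulrnBl. Qed.

(** Modulo torsion, a unipotent map of finite order is the identity. Descending on [n], one reaches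
    [y (y (k a)) = 0]; then [phi^j (k a) = k a + j y (k a)], and [j = m] gives [m y (k a) = 0]. *)
Lemma unipotent_torsion m : (0 < m)%N -> (forall u, iter m phi u = u) ->
  forall n a, torsion_elt (iter n y a) -> torsion_elt (y a).
Proof.
move=> m_gt0 phim; elim=> [|n IH] a.
  by case=> k k_gt0 ak; exists k; rewrite // -sub1Mn ak /phi_sub1 (additive0 phiD) subrr.
rewrite iterSr => /IH[k k_gt0 yyk].
have fixu : phi (y (a *+ k)) = y (a *+ k).
  by apply/eqP; rewrite -subr_eq0 -/(y _) !sub1Mn yyk.
have itj j : iter j phi (a *+ k) = a *+ k + y (a *+ k) *+ j.
  elim: j => [|j IHj]; first by rewrite addr0.
  rewrite iterS IHj phiD (additiveMn (y _)) fixu mulrS addrA; congr (_ + _).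
  by rewrite /phi_sub1 addrC subrK.
exists (k * m)%N; first by rewrite muln_gt0 k_gt0.
rewrite mulrnA -sub1Mn; apply: (@addrI _ (a *+ k)).
by rewrite -itj phim addr0.
Qed.

Lemma torsion_sum (J : finType) (F : J -> V) :
  (forall j, torsion_elt (F j)) -> torsion_elt (\sum_j F j).
Proof.
move=> tF; elim/big_rec: _ => [|j u _ [k k_gt0 uk]]; first by exists 1%N.
have [l l_gt0 fl] := tF j; exists (l * k)%N; first by rewrite muln_gt0 l_gt0.
by rewrite mulrnDl mulrnA fl mul0rn add0r mulnC mulrnA uk mul0rn.
Qed.

End UnipotentTorsion.

(** * Lifting a non-Engel action from a quotient *)

Section LiftNonEngel.
Variables (G : Group) (A : ab_sub G).
Hypothesis nA : normalised A (setT G).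
Hypothesis engA : forall x, engel_on x A.
Variables (E : gset G) (x : G).
Hypotheses (sE : sg E) (sAE : forall g, A g -> E g).
Hypothesis fiE : finite_index _ A E.
Hypothesis xE : forall g, E g -> E (gconj g x).
Local Open Scope grp_scope.

Let sA := ab_sg A.

(** The inverse of [r i] acts on [A] with finite order, as a power of it lies in [A], and
    unipotently on [a] by the Engel condition; so it moves [a] by a torsion element only. Hence the
    norm of [a] is [m.+1] times [a] modulo torsion. *)
Lemma norm_kernel_torsion m (r : 'I_m.+1 -> G) a : (forall i, E (r i)) -> A a ->
  (\sum_i ab_conj nA (r i)^-1%grp (to_ab A a) = 0)%R ->
  exists2 k, 0 < k & gpow _ a k = 1.
Proof.
move=> rE Aa s0.
have tor i : torsion_elt (phi_sub1 (ab_conj nA (r i)^-1) (to_ab A a)).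
  have [M M_gt0 AM] := pigeonhole_pow sA sE fiE (sgV sE (rE i)).
  have [n en] := engA (r i)^-1 Aa.
  apply: (unipotent_torsion (ab_conjD nA _) M_gt0 _ (n := n)).
    move=> u; have it j : forall v, sval (iter j (ab_conj nA (r i)^-1) v) = sval v ^ gpow _ (r i)^-1 j.
      elim: j => [|j IHj] v; first by rewrite conjg1.
      by rewrite iterSr IHj /= -conjJM.
    have H : sval (iter M (ab_conj nA (r i)^-1) u) = sval u.
      by rewrite it; apply/conj_eq_comm; apply: (@ab_comm _ A) => //; case: (u).
    by apply: eq_sig_hprop H => ?; apply: Prop_irrelevance.
  exists 1%N => //; rewrite GRing.mulr1n; apply/ab_eq0.
  by rewrite val_iter_sub1 to_abK.
have [k k_gt0] := torsion_sum tor.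
rewrite /phi_sub1 GRing.sumrB s0 GRing.sub0r GRing.sumr_const card_ord.
rewrite GRing.mulNrn -GRing.mulrnA => /eqP; rewrite GRing.oppr_eq0 => /eqP/ab_eq0.
rewrite val_mulrn to_abK // => e; exists (m.+1 * k)%N; by rewrite ?muln_gt0 ?k_gt0.
Qed.

(** [P] is the union of the cosets [r i Q]. The list [l0] records how far the [r i] are from being
    closed under products, inverses and conjugation by [x]; [Q] is the stable subgroup that it
    generates, finite because it is finitely generated, abelian and torsion. *)
Lemma finite_stable_subgroup (T : gset G) t : sg T -> (forall g, T g -> T (g ^ x)) ->
  (forall g, T g -> E g) -> (forall a, T a -> A a -> exists2 k, 0 < k & gpow _ a k = 1) ->
  T t -> exists P, [/\ sg P, finite_set _ P, forall u, P u -> P (u ^ x) & P t].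
Proof.
move=> sT xT sTE torT Tt.
have fiT : finite_index _ A T by have [l hl] := fiE; exists l => k /sTE; apply: hl.
have [q [r [ix [rT ixP ixU]]]] := transversal sA (sg1 sT) fiT.
pose A1 g := A g /\ T g.
have sA1 : sg A1.
  split; first by split; apply: sg1.
  split=> [u v [Au Tu] [Av Tv] | u [Au Tu]].
    by split; [apply: (sgM sA) | apply: (sgM sT)].
  by split; [apply: (sgV sA) | apply: (sgV sT)].
pose d g := (r (ix g))^-1 * g.
have dA1 g : T g -> A1 (d g).
  by move=> Tg; split; [apply: ixP | apply: (sgM sT) => //; apply: (sgV sT)].
have [l1 [in1 out1]] := finite_range (fun ij : 'I_q.+1 * 'I_q.+1 => d (r ij.1 * r ij.2)).
have [l2 [in2 out2]] := finite_range (fun i => d (r i ^ x)).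
have [l3 [in3 out3]] := finite_range (fun i => d (r i)^-1).
(* [d 1] is needed because the representative of the coset of 1 may differ from 1; [d t] puts [t]
   into [P]. *)
pose l0 := (d 1 :: d t :: l1 ++ l2 ++ l3)%SEQ.
have l0A : subset _ (elts l0) A1.
  move=> u [<- | [<- |]]; [exact: dA1 (sg1 sT) | exact: dA1 |].
  case/List.in_app_iff=> [/out1[[i j] ->] | /List.in_app_iff[/out2[i ->] | /out3[i ->]]].
  - by apply: dA1; apply: (sgM sT).
  - by apply: dA1; apply: xT.
  - by apply: dA1; apply: (sgV sT).
have cA1 u : A1 u -> A1 [c u, x].
  move=> [Au Tu]; rewrite comm_conj; split.
    by apply: (sgM sA); [apply: (sgV sA) | apply: nA].
  by apply: (sgM sT); [apply: (sgV sT) | apply: xT].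
have eA1 : engel_on x A1 by move=> u [Au _]; apply: engA.
(* Closing under commutation with [x] before conjugating by the [r j] is what makes [Q] stable under
   [x]. *)
have [l [sl lA cl]] := engel_closure eA1 cA1 l0A.
have [ls [inS outS]] := finite_range (fun ij : 'I_(length l) * 'I_q.+1 => List.nth ij.1 l 1 ^ r ij.2).
set Q := gen (elts ls); have sQ : sg Q := gen_sg _.
have lsA1 : subset _ (elts ls) A1.
  move=> _ /outS[[i j] ->] /=.
  have [Au Tu] : A1 (List.nth i l 1) by apply: lA; apply: List.nth_In; apply/ltP.
  by split; [apply: nA | apply: (sgJ sT)].
have QA1 : subset _ Q A1 by apply: gen_min.
have lQ u g : elts l u -> T g -> Q (u ^ g).
  move=> lu Tg; have [i [/ltP lt_i e]] := List.In_nth _ _ 1 lu.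
  have Au : A u by case: (lA u lu).
  have -> : u ^ g = u ^ r (ix g).
    have -> : g = r (ix g) * ((r (ix g))^-1 * g) by geq.
    rewrite conjJM (_ : ix (r _ * _) = ix g); last by congr ix; geq.
    by apply/conj_eq_comm; apply: (@ab_comm _ A); [apply: nA | apply: ixP].
  by apply: gen_in; have := inS (Ordinal lt_i, ix g); rewrite /= e.
have QT u g : Q u -> T g -> Q (u ^ g).
  move=> Qu Tg; apply: (Qu _ (sg_conj g sQ)) => _ /outS[[i j] ->] /=.
  rewrite -conjJM; apply: lQ; last exact: (sgM sT).
  by apply: List.nth_In; apply/ltP.
have Qx u : Q u -> Q (u ^ x).
  move=> Qu; apply: (Qu _ (sg_conj x sQ)) => _ /outS[[i j] ->] /=.
  set v := List.nth i l 1; have lv : elts l v by apply: List.nth_In; apply/ltP.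
  have -> : (v ^ r j) ^ x = v ^ (r j ^ x) * [c v, x] ^ (r j ^ x) by ceq.
  apply: (sgM sQ); first by apply: lQ => //; apply: xT.
  by case: (cl v lv) => [-> | lc]; [rewrite conj1g; apply: (sg1 sQ) | apply: lQ => //; apply: xT].
have Ql u : elts l0 u -> Q u.
  by move=> lu; rewrite -[u]conjg1; apply: lQ (sg1 sT); apply: sl.
have [lQf hQ] : finite_set _ Q.
  apply: torsion_abelian_finite => [u v /lsA1[Au _] /lsA1[Av _] | u /lsA1[Au Tu]].
    exact: (@ab_comm _ A).
  exact: torT.
pose P g := exists i, Q ((r i)^-1 * g).
have Pd i g : T g -> elts l0 (d g) -> P g by move=> Tg lg; exists (ix g); apply: Ql.
have dP1 : elts l0 (d 1) by left.
have dPt : elts l0 (d t) by right; left.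
have d1 i j : elts l0 (d (r i * r j)).
  by right; right; apply/List.in_app_iff; left; apply: (in1 (i, j)).
have d2 i : elts l0 (d (r i ^ x)).
  by right; right; apply/List.in_app_iff; right; apply/List.in_app_iff; left; apply: in2.
have d3 i : elts l0 (d (r i)^-1).
  by right; right; apply/List.in_app_iff; right; apply/List.in_app_iff; right; apply: in3.
have PM g u : T g -> elts l0 (d g) -> Q u -> P (g * u).
  move=> Tg lg Qu; exists (ix g); have -> : (r (ix g))^-1 * (g * u) = d g * u by rewrite /d; geq.
  by apply: (sgM sQ) => //; apply: Ql.
exists P; split.
- split; first by rewrite -(gmulr1 1); apply: PM => //; [apply: sg1 | apply: sg1].
  split=> [g h [i Qg] [j Qh] | g [i Qg]].
    have -> : g * h = r i * r j * (((r i)^-1 * g) ^ r j * ((r j)^-1 * h)) by ceq.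
    by apply: PM => //; [apply: (sgM sT) | apply: (sgM sQ) => //; apply: QT].
  have -> : g^-1 = (r i)^-1 * (((r i)^-1 * g)^-1 ^ (r i)^-1) by ceq.
  by apply: PM => //; [apply: (sgV sT) | apply: QT; [apply: (sgV sQ) | apply: (sgV sT)]].
- exists (List.flat_map (fun u => List.map (fun i => r i * u) (enum 'I_q.+1)) lQf) => g [i Qg].
  apply/List.in_flat_map; exists ((r i)^-1 * g); split; first exact: hQ.
  by apply/List.in_map_iff; exists i; split; [geq | apply/In_mem; rewrite mem_enum].
- move=> g [i Qg]; have -> : g ^ x = r i ^ x * ((r i)^-1 * g) ^ x by ceq.
  by apply: PM => //; [apply: xT | apply: Qx].
by rewrite -(gmulr1 t); apply: PM => //; apply: sg1.
Qed.

(** As [V] commutes with [x] and [x] is Engel on [A], some [[e, x, ..., x]] lies in the kernel [T]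
    of [V], whose intersection with [A] is torsion. *)
Lemma nonengel_lift e : E e -> (forall n, eng e x n <> 1) -> finite_nonengel x.
Proof.
move=> Ee hne.
have [m [r [ix [rE ixP ixU]]]] := transversal sA (sg1 sE) fiE.
pose V := transfer A r ix.
have VM := transferM nA sE rE ixP ixU.
have VJ := transferJ nA sE rE ixP ixU xE.
pose T g := E g /\ V g = 0%R.
have sT : sg T.
  split; first by split; [apply: sg1 | apply: transfer1 ixU].
  split=> [g h [Eg Vg] [Eh Vh] | g [Eg Vg]].
    by split; [apply: (sgM sE) | rewrite /V VM // -/V Vg Vh GRing.addr0].
  split; [exact: (sgV sE) | rewrite /V (transferV nA sE rE ixP ixU) //].
  by rewrite -/(V g) Vg GRing.oppr0.
have xT g : T g -> T (g ^ x).
  move=> [Eg Vg]; split; first exact: xE.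
  by rewrite /V VJ // -/(V g) Vg (additive0 (ab_conjD nA x)).
have engE n : E (eng e x n).
  elim: n => //= n IH; rewrite comm_conj.
  by apply: (sgM sE); [apply: (sgV sE) | apply: xE].
have Veng n : V (eng e x n) = iter n (phi_sub1 (ab_conj nA x)) (V e).
  elim: n => //= n <-; rewrite comm_conj /V VM //; [|exact: (sgV sE)|exact: xE].
  by rewrite (transferV nA sE rE ixP ixU) // VJ // GRing.addrC.
have [n en] := engA x (proj2_sig (V e)).
have [|||P [sP fP xP Pt]] := finite_stable_subgroup (t := eng e x n) sT xT.
- by move=> g [].
- move=> a [_ Va] Aa; apply: (norm_kernel_torsion rE Aa).
  by rewrite -(transfer_ab nA sE sAE rE ixU).
- split=> //; rewrite Veng; apply/ab_eq0.
  by rewrite val_iter_sub1.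
exists P; split=> //; exists (eng e x n) => // k; rewrite -engD; exact: hne.
Qed.

End LiftNonEngel.

Lemma nonengel_finite d (G : Group) (g x : G) :
  meta_nil_hamiltonian G -> trivial_set _ (derived _ (setT G) d) ->
  (forall n, eng g x n <> (1)%grp) -> exists x0 : G, finite_nonengel x0.
Proof.
elim: d G g x => [|d IH] G g x mnh td hne; first by case: (hne 0); apply: td.
have sD := derived_sg d (@sgT G).
have comD u v : derived _ (setT G) d u -> derived _ (setT G) d v -> (u * v = v * u)%grp.
  by move=> Du Dv; apply/comm_eq1; apply: td; apply: commsub_in.
pose A := AbSub sD comD.
have nA : normalised A (setT G) by apply: normalised_derived.
have [[x0 [a [Aa ha]]] | allE] := pselect (exists x0 a, A a /\ forall n, eng a x0 n <> (1)%grp).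
  by exists x0; exact (nonengel_abelian mnh nA Aa ha).
have engA x0 : engel_on x0 A.
  move=> a Aa; apply: contrapT => no; apply: allE; exists x0, a; split=> // n en.
  by apply: no; exists n.
have [Q [f [fM fS fK]]] := exists_quotient sD nA.
have [||| q [F [sF [l hl] Fq [u Fu hu]]]] := IH Q (f g) (f x).
- exact: mnh_hom fM fS mnh.
- move=> q; rewrite -(img_setT fS) => /(img_derived fM)[h Dh <-]; exact/fK.
(* If the chain of commutators entered [A], it would reach 1 by the Engel condition on [A]. *)
- move=> n; rewrite -(hom_eng fM) => /fK /(engA x)[k]; rewrite -engD; exact: hne.
have [x1 ex1] := fS q; have [e ee] := fS u.
have [s hs] := choice fS.
exists x1; apply: (@nonengel_lift G A nA engA (fun h => F (f h)) x1 _ _ _ _ e).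
- exact: preim_sg.
- by move=> h /fK->; apply: sg1.
- exists (List.map s l) => k Fk; exists (s (f k)); split; first by apply: List.in_map; apply: hl.
  by apply/fK; rewrite fM (homV fM) hs gmulV.
- by move=> h Fh; rewrite (homJ fM) ex1; apply: Fq.
- by rewrite ee.
by move=> n /(congr1 f); rewrite (hom_eng fM) ex1 ee (hom1 fM); apply: hu.
Qed.

(** * Finiteness of the derived subgroup *)

Section DerivedFinite.
Variable G : Group.
Implicit Types (x y g h : G) (H K N Y : gset G).
Local Open Scope grp_scope.

Lemma mulset_finite M N : sg M -> sg N -> normalised N (setT G) ->
  finite_set _ M -> finite_set _ N -> finite_set _ (mulset M N).
Proof.
move=> sM sN nN [lM hM] [lN hN].
exists (List.flat_map (fun m => List.map (fun n => m * n) lN) lM) => z.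
suff: mulset M N z -> exists m n, [/\ M m, N n & z = m * n].
  move=> h /h[m [n [Mm Nn ->]]]; apply/List.in_flat_map; exists m; split; first exact: hM.
  by apply: List.in_map; apply: hN.
apply: (gen_min (H := fun z => exists m n, [/\ M m, N n & z = m * n])) => [|y []]; last 2 first.
- by move=> My; exists y, 1; rewrite gmulr1; split=> //; apply: sg1.
- by move=> Ny; exists 1, y; rewrite gmul1; split=> //; apply: sg1.
split; first by exists 1, 1; rewrite gmul1; split=> //; apply: sg1.
split=> [_ _ [m [n [Mm Nn ->]]] [m' [n' [Mm' Nn' ->]]] | _ [m [n [Mm Nn ->]]]].
  exists (m * m'), (n ^ m' * n'); split; last by ceq.
    exact: (sgM sM).
  by apply: (sgM sN) => //; apply: nN.
exists m^-1, (n^-1 ^ m^-1); split; last by ceq.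
  exact: (sgV sM).
by apply: nN => //; apply: (sgV sN).
Qed.

(** Modulo [Y] the element [g] is central; the product of such [Y] over finitely many generators
    contains [G']. *)
Definition finite_central_cover g := exists Y,
  [/\ sg Y, normalised Y (setT G), finite_set _ Y & forall h, Y [c g, h]].

Lemma derived_finite : finitely_generated G -> (forall g, finite_central_cover g) ->
  finite_set _ (derived_subgroup G).
Proof.
move=> [l hl] cov.
have [Y [sY nY fY hY]] : exists Y, [/\ sg Y, normalised Y (setT G), finite_set _ Y &
    forall g, elts l g -> forall h, Y [c g, h]].
  elim: l {hl} => [|g l [Y [sY nY fY hY]]].
    exists (fun y => y = 1); split=> //; first exact: trivial_sg.
      by move=> u h _ ->; rewrite conj1g.
    by exists (1 :: nil)%SEQ => y ->; left.
  have [Z [sZ nZ fZ hZ]] := cov g.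
  exists (mulset Z Y); split; first exact: gen_sg.
  - exact: mulset_normal.
  - exact: mulset_finite.
  by move=> k [<- h | lk h]; apply: gen_in; [left | right; apply: hY].
have comY a b : Y [c a, b].
  have [] // := hl a _ (comm_subgroup_l b sY (sgT (G := G)) nY).
  by move=> g lg; split=> //; apply: hY.
have [s hs] := fY; exists s => z dz; apply: hs.
by move: z dz; apply: commsub_min.
Qed.

Lemma comm_in_cycle_r g h : (forall H, sg H -> H h -> normalised H (setT G)) ->
  exists j : int, [c g, h] = zpow h j.
Proof.
move=> nH; apply: gen_cycle; have sC := gen_sg (fun y => y = h).
have Ch : generated G (fun y => y = h) h by apply: gen_in.
have -> : [c g, h] = (h^-1) ^ g * h by ceq.
by apply: (sgM sC) => //; apply: (nH _ sC Ch) => //; apply: (sgV sC).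
Qed.

Lemma comm_in_cycle_l g h : (forall H, sg H -> H g -> normalised H (setT G)) ->
  exists i : int, [c g, h] = zpow g i.
Proof.
move=> nH; apply: gen_cycle; have sC := gen_sg (fun y => y = g).
have Cg : generated G (fun y => y = g) g by apply: gen_in.
rewrite comm_conj; apply: (sgM sC); first exact: (sgV sC).
exact: (nH _ sC Cg).
Qed.

(* [[g, h] = g^i] is also a power of [h], hence fixed by [h]; comparing exponents, [i^2 = 0]. *)
Lemma dedekind_infinite_central g h : (forall H, sg H -> normalised H (setT G)) ->
  (forall k, 0 < k -> gpow _ g k <> 1) -> [c g, h] = 1.
Proof.
move=> nH inf.
have [i ei] := comm_in_cycle_l (g := g) h (fun H sH _ => nH H sH).
have [j ej] := comm_in_cycle_r (h := h) g (fun H sH _ => nH H sH).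
have fixh : zpow g i ^ h = zpow g i.
  by rewrite -ei ej; apply/conj_eq_comm/zpow_comm.
have gh : g ^ h = zpow g (1 + i)%R by rewrite zpowD zpow1 -ei conj_comm.
have : zpow g (i * i)%R = 1.
  apply: (@gmulI _ (zpow g i)); rewrite gmulr1 -zpowD -[RHS]fixh zpow_conj gh -zpowM.
  by rewrite GRing.mulrDl GRing.mul1r.
move/(zpow_inf inf)/eqP; rewrite GRing.mulf_eq0 orbb => /eqP i0.
by rewrite ei i0.
Qed.

End DerivedFinite.

(** An element of infinite order is central; one of finite order is covered by the finite normal
    subgroup it generates. *)
Lemma dedekind_derived_finite (G : Group) : finitely_generated G ->
  (forall H, is_subgroup G H -> normalised H (setT G)) -> finite_set _ (derived_subgroup G).
Proof.
move=> fg nH; apply: derived_finite => // g.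
have [[k k_gt0 gk] | inf] := pselect (exists2 k, 0 < k & gpow _ g k = (1)%grp).
  have sC := gen_sg (elts (g :: nil)%SEQ); exists (generated G (elts (g :: nil)%SEQ)); split=> //.
  - exact: nH.
  - apply: torsion_abelian_finite; first by move=> u v [<- | []] [<- | []].
    by move=> u [<- | []]; exists k.
  move=> h; have gC : generated G (elts (g :: nil)%SEQ) g by apply: gen_in; left.
  by rewrite comm_conj; apply: (sgM sC); [apply: (sgV sC) | apply: (nH _ sC)].
exists (fun y => y = (1)%grp); split; first exact: trivial_sg.
- by move=> u h _ ->; rewrite conj1g.
- by exists ((1)%grp :: nil)%SEQ => y ->; left.
move=> h; apply: dedekind_infinite_central => // k k_gt0 gk.
by apply: inf; exists k.
Qed.

(** * The case where [x] has infinite order and is non-Engel modulo nothing finite: normality above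
    the powers [x^(1 + s l)] *)

Section InfiniteCase.
Variables (G : Group) (x : G) (s : nat).
Hypothesis s_gt0 : 0 < s.
Hypothesis x_inf : forall k, 0 < k -> gpow _ x k <> (1)%grp.
Hypothesis x_normal : forall l (H : gset G), is_subgroup G H -> H (gpow _ x (1 + s * l)) ->
  normalised H (setT G).
Local Open Scope grp_scope.
Implicit Types (g h : G).

(** A non-zero multiple of [1 + s (|i| + 1)] exceeds [|i|]. Thus a single [l], chosen in terms of
    [i], replaces divisibility by all [1 + s l]. *)
Lemma large_multiple (i j : int) : (i = (1 + s * (absz i).+1)%N%:Z * j)%R -> i = 0%R.
Proof.
move=> e; have [j0 | nzj] := eqVneq j 0%R; first by rewrite e j0 GRing.mulr0.
exfalso; have : absz i = ((1 + s * (absz i).+1) * absz j)%N by rewrite {1}e abszM.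
have : 0 < absz j by rewrite absz_gt0.
move: (absz j) (absz i) => b a b_gt0 e'.
have : a < a; last by rewrite ltnn.
rewrite {2}e' (leq_trans _ (leq_pmulr _ b_gt0)) // add1n ltnS.
by rewrite (leq_trans (leqnSn a)) // leq_pmull.
Qed.

(** Let [[x, h] = x^i] and [k = 1 + s (|i| + 1)]. Normality of [<h, x^k>] gives [[x, h] = x^(k b)
    h^j], so [x^(i - k b)] is a power of [h], hence fixed by [h]. As [x^h = x^(1 + i)], this means
    [i (i - k b) = 0], and [i = k b] forces [i = 0] too. *)
Lemma x_central h : x * h = h * x.
Proof.
have [|i ei] := comm_in_cycle_l (g := x) h.
  by move=> H sH Hx; apply: (@x_normal 0) => //; rewrite muln0 gpow1.
suff i0 : i = 0%R by apply/comm_eq1; rewrite ei i0.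
have xh : x ^ h = zpow x (1 + i)%R by rewrite zpowD zpow1 -ei conj_comm.
pose l := (absz i).+1; pose y := gpow _ x (1 + s * l).
have sC := gen_sg (fun z => z = y); set C := gen _ in sC.
have Cy : C y by apply: gen_in.
have nC : normalised C (setT G) by apply: (@x_normal l).
pose H := gen (fun z => z = h \/ C z); have sH : sg H := gen_sg _.
have Hh : H h by apply: gen_in; left.
have nH : normalised H (setT G) by apply: (@x_normal l) => //; apply: gen_in; right.
have Hc : H [c x, h].
  have -> : [c x, h] = (h^-1) ^ x * h by ceq.
  by apply: (sgM sH) => //; apply: nH => //; apply: (sgV sH).
have [|f [j [Cf ef]]] := gen_cycle_ext sC _ Hc; first by move=> u Cu; split; apply: nC.
have [b eb] := gen_cycle Cf.
pose k : int := (1 + s * l)%N.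
have yE : y = zpow x k by [].
have hj : zpow h j = zpow x (i - k * b)%R.
  have -> : zpow h j = f^-1 * (f * zpow h j) by geq.
  by rewrite -ef ei eb yE -zpowM -zpowN -zpowD GRing.addrC.
have fixh : zpow x (i - k * b)%R ^ h = zpow x (i - k * b)%R.
  by rewrite -hj; apply/conj_eq_comm/zpow_comm.
have : zpow x (i * (i - k * b))%R = 1.
  apply: (@gmulI _ (zpow x (i - k * b)%R)); rewrite gmulr1 -zpowD -[RHS]fixh zpow_conj xh -zpowM.
  by rewrite GRing.mulrDl GRing.mul1r.
move/(zpow_inf x_inf)/eqP; rewrite GRing.mulf_eq0 => /orP[/eqP // | ].
by rewrite GRing.subr_eq0 => /eqP/large_multiple.
Qed.

Lemma x_pow_central (a : int) h : zpow x a * h = h * zpow x a.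
Proof. exact: zpow_comm (x_central h). Qed.

(** Modulo [<x^(1 + s l)>] all subgroups are normal and [g] has infinite order, so [[g, h]] lies in
    each of these cyclic groups, and they intersect trivially. *)
Lemma cover_infinite g : (forall n, 0 < n -> forall a : int, gpow _ g n <> zpow x a) ->
  forall h, [c g, h] = 1.
Proof.
move=> infg h.
have inC l : exists a : int, [c g, h] = zpow (gpow _ x (1 + s * l)) a.
  apply: gen_cycle; set y := gpow _ x _; have sC := gen_sg (fun z => z = y).
  have Cy : generated G (fun z => z = y) y by apply: gen_in.
  have nC : normalised (generated G (fun z => z = y)) (setT G) by apply: (@x_normal l).
  have [Q [f [fM fS fK]]] := exists_quotient sC nC.
  apply/fK; rewrite (homR fM); apply: dedekind_infinite_central => [H sH | k k_gt0].
    have nP : normalised (fun z => H (f z)) (setT G).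
      apply: (@x_normal l); first exact: preim_sg.
      by have /fK-> := Cy; apply: sg1.
    move=> u v _ Hu; have [u' eu] := fS u; have [v' ev] := fS v.
    by rewrite -eu -ev -(homJ fM); apply: nP => //; rewrite eu.
  have fP j : gpow _ (f g) j = f (gpow _ g j).
    by elim: j => [|j IH]; rewrite ?(hom1 fM) // !gpowS fM IH.
  rewrite fP => /fK/gen_cycle[a ea]; apply: (infg k k_gt0 ((1 + s * l)%N%:Z * a)%R).
  by rewrite ea zpowM.
have [a ea] := inC 0; rewrite muln0 gpow1 in ea.
have [b eb] := inC (absz a).+1.
suff a0 : a = 0%R by rewrite ea a0.
apply: (@large_multiple a b); apply/eqP; rewrite -GRing.subr_eq0; apply/eqP.
by apply: (zpow_inf x_inf); rewrite zpowD zpowN zpowM -eb -ea gmulrV.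
Qed.

(** [C = <g, x>] is abelian, and normal since it contains [x]; [Y] is its torsion subgroup. It is
    finite because each coset [g^r <x>], [r < n], has at most one torsion element. Finally [[g, h]^n
    = 1] because [g^n] is central. *)
Lemma cover_torsion g n (a : int) : 0 < n -> gpow _ g n = zpow x a -> finite_central_cover g.
Proof.
move=> n_gt0 gn.
pose C z := exists i j : int, z = zpow g i * zpow x j.
have CM i j i' j' : (zpow g i * zpow x j) * (zpow g i' * zpow x j') = zpow g (i + i')%R * zpow x (j + j')%R.
  rewrite !zpowD !gmulA; congr (_ * _); rewrite -!gmulA; congr (_ * _).
  exact: x_pow_central.
have sC : sg C.
  split; first by exists 0%R, 0%R; geq.
  split=> [_ _ [i [j ->]] [i' [j' ->]] | _ [i [j ->]]].
    by exists (i + i')%R, (j + j')%R; rewrite CM.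
  exists (- i)%R, (- j)%R; apply: (@gmulI _ (zpow g i * zpow x j)).
  by rewrite gmulrV CM !GRing.subrr gmul1.
have nC : normalised C (setT G).
  apply: (@x_normal 0) => //; rewrite muln0 gpow1; exists 0%R, 1%R.
  by rewrite gmul1 zpow1.
have abC u v : C u -> C v -> u * v = v * u.
  by move=> [i [j ->]] [i' [j' ->]]; rewrite !CM GRing.addrC [(j' + j)%R]GRing.addrC.
pose Y z := C z /\ exists2 k, 0 < k & gpow _ z k = 1.
have powM u v k : u * v = v * u -> gpow _ (u * v) k = gpow _ u k * gpow _ v k.
  move=> e; elim: k => [|k IH]; first by geq.
  rewrite !gpowS IH !gmulA; congr (_ * _); rewrite -!gmulA; congr (_ * _).
  by rewrite gpow_comm.
exists Y; split.
- split; first by split; [apply: sg1 | exists 1%N => //; rewrite gpow1].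
  split=> [u v [Cu [k k_gt0 uk]] [Cv [l l_gt0 vl]] | u [Cu [k k_gt0 uk]]].
    split; first exact: (sgM sC).
    exists (k * l)%N; first by rewrite muln_gt0 k_gt0.
    by rewrite powM; [rewrite gpowM uk gpow_1 mulnC gpowM vl gpow_1 gmul1 | apply: abC].
  split; first exact: (sgV sC).
  exists k => //; apply: (@gmulI _ (gpow _ u k)).
  rewrite -powM; first by rewrite gmulrV gpow_1 uk gmul1.
  by rewrite gmulrV gmulV.
- move=> u h _ [Cu [k k_gt0 uk]]; split; first exact: nC.
  by exists k; rewrite // -gpow_conj uk conj1g.
- have hch (r : nat) : exists z, forall j : int, Y (zpow g r%:Z * zpow x j) -> z = zpow g r%:Z * zpow x j.
    have [[j Yj] | no] := pselect (exists j : int, Y (zpow g r%:Z * zpow x j)); last first.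
      by exists 1 => j Yj; case: no; exists j.
    exists (zpow g r%:Z * zpow x j) => j' Yj'; congr (_ * zpow x _).
    case: Yj Yj' => [C1 [k k_gt0 e1]] [C2 [l l_gt0 e2]].
    apply/eqP; rewrite -GRing.subr_eq0; apply/eqP.
    have: ((j - j') * (k * l)%N%:Z = 0)%R.
      apply: (zpow_inf x_inf); rewrite zpowMn.
      have -> : zpow x (j - j')%R = (zpow g r%:Z * zpow x j) * (zpow g r%:Z * zpow x j')^-1.
        have -> : zpow g r%:Z * zpow x j = zpow x (j - j')%R * (zpow g r%:Z * zpow x j').
          by rewrite -gmulA x_pow_central gmulA -zpowD GRing.subrK.
        by geq.
      rewrite powM; last by apply: abC => //; apply: (sgV sC).
      rewrite gpowM e1 gpow_1 gmul1 mulnC gpowM.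
      set v := zpow g r%:Z * zpow x j' in e2 *.
      have -> : gpow _ v^-1 l = 1; last exact: gpow_1.
      apply: (@gmulI _ (gpow _ v l)); rewrite -powM; first by rewrite gmulrV gpow_1 e2 gmul1.
      by rewrite gmulrV gmulV.
    by move/eqP; rewrite GRing.mulf_eq0 eqz_nat muln_eq0 (gtn_eqF k_gt0) (gtn_eqF l_gt0) /= orbF => /eqP.
  have [z hz] := choice hch; exists (List.map z (iota 0 n)) => y Yy.
  have [[i [j ey]] _] := Yy.
  have [r [q [lt_rn ei]]] : exists (r : nat) (q : int), r < n /\ i = (r%:Z + n%:Z * q)%R.
    have nz_n : (n%:Z != 0)%R by rewrite eqz_nat -lt0n.
    exists (absz (modz i n)), (divz i n).
    have ge0 := modz_ge0 i nz_n.
    rewrite -ltz_nat gez0_abs // ltz_pmod // ; split=> //.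
    by rewrite GRing.addrC GRing.mulrC -divz_eq.
  have {}ey : y = zpow g r%:Z * zpow x (a * q + j)%R.
    by rewrite ey ei zpowD (zpowM g n%:Z) [zpow g n%:Z]gn -zpowM gmulA -zpowD.
  rewrite ey -(hz r (a * q + j)%R) -?ey //.
  by apply: List.in_map; apply/In_mem; rewrite mem_iota.
move=> h; have Cg : C g by exists 1%R, 0%R; rewrite zpow1 gmulr1.
have Cgh : C [c g, h].
  by rewrite comm_conj; apply: (sgM sC); [apply: (sgV sC) | apply: nC].
split=> //; exists n => //; apply: (@gmulI _ (gpow _ g n)).
rewrite -powM; last exact: abC.
by rewrite -conj_comm -gpow_conj gn gmulr1; apply/conj_eq_comm/x_pow_central.
Qed.

Lemma infinite_case_derived_finite : finitely_generated G -> finite_set _ (derived_subgroup G).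
Proof.
move=> fg; apply: derived_finite => // g.
have [[n [n_gt0 [a gn]]] | no] := pselect (exists n, 0 < n /\ exists a : int, gpow _ g n = zpow x a).
  exact: cover_torsion gn.
exists (fun y => y = 1); split; first exact: trivial_sg.
- by move=> u h _ ->; rewrite conj1g.
- by exists (1 :: nil)%SEQ => y ->; left.
by apply: cover_infinite => n n_gt0 a gn; apply: no; exists n; split=> //; exists a.
Qed.

End InfiniteCase.

(** * From a finite non-Engel action to a finite derived subgroup *)

Section FiniteNonEngel.
Variable G : Group.
Local Open Scope grp_scope.
Implicit Types (x u h : G) (N F H : gset G).

Lemma derived_finite_ext N (Q : Group) (f : G -> Q) : is_hom f -> (forall q, exists g, f g = q) ->
  (forall g, f g = 1 <-> N g) -> finite_set _ N ->
  finite_set _ (derived_subgroup Q) -> finite_set _ (derived_subgroup G).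
Proof.
move=> fM fS fK [lN hN] [lQ hQ]; have [s hs] := choice fS.
exists (List.flat_map (fun q => List.map (fun n => s q * n) lN) lQ) => g dg.
have dfg : derived_subgroup Q (f g).
  move: g dg; apply: commsub_min; first exact: preim_sg (gen_sg _).
  by move=> a b _ _; rewrite (homR fM); apply: commsub_in.
apply/List.in_flat_map; exists (f g); split; first exact: hQ.
apply/List.in_map_iff; exists ((s (f g))^-1 * g); split; first by geq.
by apply: hN; apply/fK; rewrite fM (homV fM) hs gmulV.
Qed.

Lemma finite_conj_period F x : finite_set _ F -> (forall u, F u -> F (u ^ x)) ->
  exists2 s, 0 < s & forall u, F u -> u ^ gpow _ x s = u.
Proof.
move=> [l hl] Fx.
have FxN n u : F u -> F (u ^ gpow _ x n).
  elim: n u => [|n IH] u Fu; first by rewrite conjg1.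
  by rewrite gpowS conjJM; apply: IH; apply: Fx.
have per u : F u -> exists2 s, 0 < s & u ^ gpow _ x s = u.
  move=> Fu; have [n|i [j [lt_ij e]]] := @list_pigeonhole _ l (fun n => u ^ gpow _ x n).
    by apply: hl; apply: FxN.
  exists (j - i)%N; first by rewrite subn_gt0.
  rewrite -[RHS](conjK _ (gpow _ x i)) e -conjJM; congr (_ ^ _).
  by rewrite -{2}(subnK (ltnW lt_ij)) gpowD; geq.
have mul_per s k u : u ^ gpow _ x s = u -> u ^ gpow _ x (s * k) = u.
  by move=> e; elim: k => [|k IH]; rewrite ?muln0 ?conjg1 // mulnS gpowD conjJM e.
suff [s s_gt0 hs] : exists2 s, 0 < s & forall u, List.In u l -> F u -> u ^ gpow _ x s = u.
  by exists s => // u Fu; apply: hs => //; apply: hl.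
elim: l {hl} => [|v l [s s_gt0 hs]]; first by exists 1%N.
have [Fv | nFv] := pselect (F v); last first.
  by exists s => // u [<- // | ]; apply: hs.
have [k k_gt0 hk] := per v Fv; exists (s * k)%N; first by rewrite muln_gt0 s_gt0.
move=> u [<- _ | lu Fu]; first by rewrite mulnC; apply: mul_per.
by apply: mul_per; apply: hs.
Qed.

Lemma finite_nonengel_derived_finite x : meta_nil_hamiltonian G -> finitely_generated G ->
  finite_nonengel x -> finite_set _ (derived_subgroup G).
Proof.
move=> mnh fg [F [sF fF Fx [u Fu hu]]].
have [s s_gt0 hs] := finite_conj_period fF Fx.
have hsl l v : F v -> v ^ gpow _ x (1 + s * l) = v ^ x.
  move=> Fv; rewrite gpowD gpow1 conjJM.
  have Fvx := Fx v Fv; elim: l => [|l IH]; first by rewrite muln0 conjg1.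
  by rewrite mulnS gpowD conjJM hs.
have FxV v : F v -> F (v ^ x^-1).
  move=> Fv; have -> : v ^ x^-1 = v ^ gpow _ x s.-1.
    have e := hs v Fv; rewrite -(prednK s_gt0) -addn1 gpowD gpow1 conjJM in e.
    by rewrite -{1}e conjK.
  elim: (s.-1) v Fv => [|n IH] v Fv; first by rewrite conjg1.
  by rewrite gpowS conjJM; apply: IH; apply: Fx.
pose y l := gpow _ x (1 + s * l).
pose K l := gen (fun z => z = y l \/ F z).
have sK l : sg (K l) := gen_sg _.
have Ky l : K l (y l) by apply: gen_in; left.
have FK l v : F v -> K l v by move=> Fv; apply: gen_in; right.
have nnK l H : sg H -> (forall v, F v -> H v) -> H (y l) -> ~ nilpotent _ H.
  move=> sH FH Hy /(nilpotent_engel sH Hy)[n hn].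
  have := hn u (FH u Fu); have -> : eng u (y l) n = eng u x n; last exact: hu.
  suff [] : eng u (y l) n = eng u x n /\ F (eng u x n) by [].
  elim: n {hn} => //= n [-> Fn]; rewrite !comm_conj hsl //; split=> //.
  by apply: (sgM sF); [apply: (sgV sF) | apply: Fx].
have nH l H : sg H -> (forall v, F v -> H v) -> H (y l) -> normalised H (setT G).
  by move=> sH FH Hy; have [_] := (normalP _).1 (mnh H sH (@nnK l H sH FH Hy)).
have Fy l v : F v -> F (v ^ y l) /\ F (v ^ (y l)^-1).
  have nFx : normalised F (gen (fun z => z = x)).
    by apply: normalised_gen sF _ => w _ -> Fw; split; [apply: Fx | apply: FxV].
  have gy : gen (fun z => z = x) (y l) by apply: gpow_sg (gen_sg _) _; apply: gen_in.
  by move=> Fv; split; apply: nFx => //; apply: (sgV (gen_sg _)).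
have KP l z : K l z -> exists f (a : int), F f /\ z = f * zpow x ((1 + s * l)%N%:Z * a)%R.
  case/(gen_cycle_ext sF (Fy l)) => f [a [Ff ->]]; exists f, a; split=> //.
  by rewrite zpowM.
(* If a power of [x] lies in [F], then [F <x>] is finite and normal, with all subgroups of the
   quotient normal. Otherwise [F] itself turns out to be normal, and [x] has infinite order modulo
   [F]. *)
have [[n n_gt0 Fxn] | inf] := pselect (exists2 n, 0 < n & F (gpow _ x n)).
  have fK0 : finite_set _ (K 0).
    have [l hl] := fF.
    exists (List.flat_map (fun f => List.map (fun j => f * gpow _ x j) (iota 0 n)) l) => z /KP.
    rewrite muln0 => -[f [a [Ff ->]]]; rewrite GRing.mul1r.
    have nz_n : (n%:Z != 0)%R by rewrite eqz_nat -lt0n.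
    apply/List.in_flat_map; exists (f * zpow x (n%:Z * divz a n)%R); split.
      by apply: hl; apply: (sgM sF) => //; rewrite zpowM; apply: zpow_sg.
    apply/List.in_map_iff; exists (absz (modz a n)); split; last first.
      apply/In_mem; rewrite mem_iota /= add0n -ltz_nat gez0_abs ?modz_ge0 //.
      by rewrite ltz_pmod.
    rewrite gmulA; congr (_ * _); rewrite -[gpow _ x _]/(zpow x (Posz _)) -zpowD gez0_abs ?modz_ge0 //.
    by rewrite GRing.mulrC -divz_eq.
  have nK : normalised (K 0) (setT G) by apply: (nH 0) => // v; apply: FK.
  have [Q [f [fM fS fK]]] := exists_quotient (sK 0) nK.
  apply: (derived_finite_ext fM fS fK fK0).
  apply: dedekind_derived_finite; first exact: finitely_generated_hom fM fS fg.
  move=> H sH; have nP : normalised (fun z => H (f z)) (setT G).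
    apply: (nH 0); first exact: preim_sg.
    - by move=> v Fv; have /fK-> := FK 0 v Fv; apply: sg1.
    - by have /fK-> := Ky 0; apply: sg1.
  move=> a b _ Ha; have [a' ea] := fS a; have [b' eb] := fS b.
  by rewrite -ea -eb -(homJ fM); apply: nP => //; rewrite ea.
have zinf (a : int) : F (zpow x a) -> a = 0%R.
  case: a => [[|n] | n] // Fa; first by case: inf; exists n.+1.
  by case: inf; exists n.+1 => //; rewrite -[gpow _ _ _]ginvK; apply: (sgV sF).
(* A conjugate [f x^a] of an element of [F] also lies in [F <x^k>] with [k = 1 + s (|a| + 1)]. As
   [F] meets [<x>] trivially, [k] divides [a], so [a = 0]. *)
have nF : normalised F (setT G).
  move=> v h _ Fv.
  have Kv l : K l (v ^ h) by apply: (nH l (K l)) => //; [move=> w; apply: FK | apply: FK].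
  have [f [a [Ff ea]]] := KP 0 _ (Kv 0); rewrite muln0 GRing.mul1r in ea.
  have [f' [b [Ff' eb]]] := KP _ _ (Kv (absz a).+1).
  rewrite ea (_ : a = 0%R) ?gmulr1 //.
  apply: (large_multiple s_gt0 (j := b)); apply/eqP; rewrite -GRing.subr_eq0; apply/eqP.
  apply: zinf; rewrite zpowD zpowN.
  set c := zpow x (_ * b)%R in eb *.
  have -> : zpow x a * c^-1 = f^-1 * f' by rewrite -(gmulKV f (zpow x a)) -ea eb; geq.
  by apply: (sgM sF) => //; apply: (sgV sF).
have [Q [f [fM fS fK]]] := exists_quotient sF nF.
apply: (derived_finite_ext fM fS fK fF).
have fP g n : f (gpow _ g n) = gpow _ (f g) n.
  by elim: n => [|n IH]; rewrite ?(hom1 fM) // !gpowS fM IH.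
apply: (@infinite_case_derived_finite Q (f x) s) => //.
- by move=> k k_gt0; rewrite -fP => /fK Fk; apply: inf; exists k.
- move=> l H sH; rewrite -fP => Hy.
  have nP : normalised (fun z => H (f z)) (setT G).
    apply: (nH l) => //; first exact: preim_sg.
    by move=> v /fK->; apply: sg1.
  move=> a b _ Ha; have [a' ea] := fS a; have [b' eb] := fS b.
  by rewrite -ea -eb -(homJ fM); apply: nP => //; rewrite ea.
exact: finitely_generated_hom fM fS fg.
Qed.

End FiniteNonEngel.

(** * Solubility *)

Definition group_of (gT : finGroupType) : Group :=
  @Build_Group gT (@mulg gT) (@invg gT) (@oneg gT) (@mulgA gT) (@fingroup.mul1g gT) (@fingroup.mulVg gT).

Section FiniteBridge.
Variable gT : finGroupType.
Implicit Types (X Y : {group gT}).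

Definition mem_gset (X : {set gT}) : gset (group_of gT) := fun s : gT => s \in X.

Lemma commE (s t : gT) : comm (group_of gT) s t = commg s t.
Proof. by rewrite /comm commgEl conjgE /= !mulgA. Qed.

Lemma gen_mem_gset (S : {set gT}) (H : gset (group_of gT)) : is_subgroup _ H ->
  (forall s, s \in S -> H s) -> forall s, s \in <<S>>%g -> H s.
Proof.
move=> sH SH s /gen_prodgP[n [c Sc ->]]; elim: n c Sc => [|n IH] c Sc.
  by rewrite big_ord0; apply: (sg1 sH).
rewrite big_ord_recl; apply: (sgM sH); first exact: SH.
by apply: IH => i; apply: Sc.
Qed.

Lemma mem_gset_sg X : is_subgroup _ (mem_gset X).
Proof.
split; first exact: group1.
by split=> [s t Xs Xt | s Xs]; [apply: groupM | apply: groupVr].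
Qed.

(** The shift is due to ['L_1(X) = X], whereas [lcs] starts at index 0. *)
Lemma lcn_lcs X n s : (s \in 'L_n.+1(X))%g -> lcs _ (mem_gset X) n s.
Proof.
elim: n s => [|n IH] s; first by rewrite lcn1.
rewrite lcnSn; apply: gen_mem_gset; first exact: gen_sg.
by move=> _ /imset2P[a b /IH La Xb ->]; rewrite -commE; apply: commsub_in.
Qed.

Lemma nilpotent_mem_gset X : nilpotent _ (mem_gset X) -> nilpotent.nilpotent X.
Proof.
case=> n tn; apply/nilpotent.lcnP; exists n; apply/trivgP/subsetP=> s /lcn_lcs/tn e.
by rewrite e set11.
Qed.

Lemma derived_der X n s : derived _ (mem_gset X) n s -> (s \in X^`(n))%g.
Proof.
elim: n s => [|n IH] s //=; rewrite dergSn.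
apply: (commsub_min (H := mem_gset [~: X^`(n), X^`(n)]%g)); first exact: mem_gset_sg.
by move=> a b /IH Xa /IH Xb; rewrite /mem_gset commE; apply: mem_commg.
Qed.

End FiniteBridge.

Section Soluble.
Variable G : Group.
Local Open Scope grp_scope.

Lemma hom_derived (Q : Group) (f : G -> Q) (H : gset G) n g : is_hom f ->
  derived _ H n g -> derived _ (img f H) n (f g).
Proof.
move=> fM; elim: n g => [|n IH] g /=; first by move=> Hg; exists g.
apply: (commsub_min (preim_sg fM (gen_sg _))) => a b /IH Da /IH Db.
by rewrite (homR fM); apply: commsub_in.
Qed.

Lemma derived_add (H : gset G) m n : derived _ H (m + n) = derived _ (derived _ H n) m.
Proof. by elim: m => //= m ->. Qed.

Lemma coset_action (H : gset G) : sg H -> finite_index _ H (setT G) ->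
  exists m (f : G -> group_of {perm 'I_m.+1}), is_hom f /\ forall g, f g = 1 -> H g.
Proof.
move=> sH fiH; have [m [r [ix [_ ixP ixU]]]] := transversal sH (I : setT G 1) fiH.
have ixM u h : H h -> ix (u * h) = ix u.
  move=> Hh; symmetry; apply: ixU => //; rewrite -gmulA; apply: (sgM sH) => //; exact: ixP.
have ixr i : ix (r i) = i by symmetry; apply: ixU; rewrite // gmulV; apply: sg1.
have ixg g u : ix (g * r (ix u)) = ix (g * u).
  have -> : g * u = g * r (ix u) * ((r (ix u))^-1 * u) by geq.
  by rewrite [RHS]ixM //; apply: ixP.
(* The inverse of [g] is used because permutations compose from left to right. *)
have inj g : injective (fun i => ix (g^-1 * r i)).
  move=> i j e; rewrite -(ixr i) -(ixr j).
  have -> : r i = g * (g^-1 * r i) by geq.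
  by rewrite -ixg e ixg gmulK.
pose f g : group_of {perm 'I_m.+1} := perm (inj g).
exists m, f; split.
  move=> g h; apply/permP=> i; rewrite [RHS]permM !permE ixg; congr ix; geq.
move=> g /permP/(_ (ix 1)); rewrite perm1 permE ixg gmulr1 => e.
have := ixP 1 I; rewrite gmulr1 => /(sgV sH); rewrite ginvK => H1.
have Hg : H g^-1.
  have -> : g^-1 = r (ix 1) * ((r (ix 1))^-1 * g^-1) by geq.
  by apply: (sgM sH) => //; rewrite -e; apply: ixP.
by rewrite -[g]ginvK; apply: (sgV sH).
Qed.

Lemma virtually_soluble_mnh (H : gset G) : meta_nil_hamiltonian G -> sg H ->
  soluble _ H -> finite_index _ H (setT G) -> soluble _ (setT G).
Proof.
move=> mnh sH [d td] fiH; have [m [f [fM fK]]] := coset_action sH fiH.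
pose X0 := [set s : {perm 'I_m.+1} | `[< exists g, f g = s >]].
have gX0 : group_set X0.
  apply/group_setP; split; first by rewrite inE; apply/asboolP; exists 1; apply: (hom1 fM).
  move=> s t; rewrite !inE => /asboolP[g <-] /asboolP[h <-].
  by apply/asboolP; exists (g * h); rewrite fM.
pose X := fingroup.Group gX0.
have XE : mem_gset X = img f (setT G).
  apply/funext=> s; apply/propext; rewrite /mem_gset inE.
  by split=> [/asboolP[g e] | [g _ e]]; [exists g | apply/asboolP; exists g].
have /nilpotent.derivedP[n Xn] : solvable X.
  apply: finite_meta_nil_hamiltonian_sol => Y sYX nnY.
  pose P g := mem_gset Y (f g).
  have sP : sg P by apply: preim_sg (mem_gset_sg Y).
  have nnP : ~ nilpotent _ P.
    move=> /(img_nilpotent fM) nilY; case/negP: nnY; apply: nilpotent_mem_gset.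
    apply: nilpotentS nilY => s Ys; have := subsetP sYX s Ys.
    by rewrite inE => /asboolP[g e]; exists g; rewrite /P ?e.
  have [_ nP] := (normalP _).1 (mnh P sP nnP).
  rewrite /normal sYX; apply/subsetP=> s; rewrite inE => /asboolP[g eg].
  rewrite inE; apply/subsetP=> _ /imsetP[t Yt ->].
  have := subsetP sYX t Yt; rewrite inE => /asboolP[h eh].
  have := nP h g I; rewrite /P eh /mem_gset => /(_ Yt).
  by rewrite (homJ fM) eh eg /gconj /= -mulgA.
(* The kernel of the action is contained in [H], so [G^(n)] lies in [H]. *)
exists (d + n) => g; rewrite derived_add => Dg; apply: td.
apply: derived_mono Dg => h /(hom_derived fM); rewrite -XE => /derived_der.
by rewrite Xn => /set1P; apply: fK.
Qed.

End Soluble.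

(** * Consequences of the finiteness of the derived subgroup *)

Section CenterIndex.
Variable G : Group.
Local Open Scope grp_scope.
Implicit Types (g h t : G).

(** Each [h] is classified by its commutators with the elements of [l]; finitely many tuples occur,
    and [R] realises each of them. *)
Lemma finite_comm_reps (l s : list G) : (forall a b, List.In [c a, b] s) ->
  exists R : list G, forall h, exists t, List.In t R /\ forall g, List.In g l -> [c g, t] = [c g, h].
Proof.
move=> hs; elim: l => [|g l [R hR]]; first by exists (1 :: nil)%SEQ => h; exists 1; split=> //; left.
have hch (rv : G * G) : exists t, forall h, (forall k, List.In k l -> [c k, h] = [c k, rv.1]) ->
    [c g, h] = rv.2 -> (forall k, List.In k l -> [c k, t] = [c k, rv.1]) /\ [c g, t] = rv.2.
  have [[t ht] | no] := pselect (exists t,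
    (forall k, List.In k l -> [c k, t] = [c k, rv.1]) /\ [c g, t] = rv.2); first by exists t.
  by exists 1 => h h1 h2; case: no; exists h.
have [w hw] := choice hch.
exists (List.flat_map (fun r => List.map (fun v => w (r, v)) s) R) => h.
have [r [Rr hr]] := hR h; exists (w (r, [c g, h])).
have [|//|w1 w2] := hw (r, [c g, h]) h; first by move=> k lk; rewrite hr.
split; last by move=> k [<- // | lk]; rewrite w1 // hr.
by apply/List.in_flat_map; exists r; split=> //; apply: (List.in_map (fun v => w (r, v))).
Qed.

(** If [t] and [h] have the same commutators with all generators, then [h t^-1] centralises the
    generators and is central. *)
Lemma center_finite_index : finitely_generated G -> finite_set _ (derived_subgroup G) ->
  finite_index _ (center G) (setT G).
Proof.
move=> [l hl] [s hs].
have [a b|R hR] := finite_comm_reps l (s := s); first by apply: hs; apply: commsub_in.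
exists R => h _; have [t [Rt ht]] := hR h; exists t; split=> //.
have [sZ nZ] := center_normal G.
suff Zht : center G (h * t^-1).
  have -> : t^-1 * h = (h * t^-1) ^ t by ceq.
  exact: nZ.
move=> z; apply/comm_eq1.
apply: (comm_gen_r (N := fun y => y = 1) (A := elts l) trivial_sg); last exact: hl.
  by move=> u k _ ->; rewrite conj1g.
move=> g lg; apply/comm_eq1; symmetry; apply/conj_eq_comm.
by rewrite conjJM (conj_comm g h) -(ht g lg) -conj_comm conjK.
Qed.

End CenterIndex.

(** * Polycyclic series *)

Section Polycyclic.
Variable G : Group.
Local Open Scope grp_scope.
Implicit Types (H K : gset G) (l : list G).

(** An inductive form lets series be extended at the top without renumbering; [polycyclic_setP]
    restores the indices. *)
Inductive polycyclic_set : gset G -> Prop :=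
| PolyTrivial H of trivial_set _ H : polycyclic_set H
| PolyStep H K x of normal_in _ K H & H x &
    set_eq _ H (gen (fun z => z = x \/ K z)) & polycyclic_set K : polycyclic_set H.

Lemma polycyclic_setP : polycyclic_set (setT G) -> polycyclic G.
Proof.
suff main H : polycyclic_set H -> exists (n : nat) (S : nat -> gset G),
    S 0 = H /\ trivial_set _ (S n) /\ forall i, (i < n)%coq_nat ->
      normal_in _ (S i.+1) (S i) /\ exists x, S i x /\
        set_eq _ (S i) (gen (fun z => z = x \/ S i.+1 z)).
  by move=> /main[n [S [e hS]]]; exists n, S; rewrite e; split.
elim=> {H} [H tH | H K x nK Hx eH _ [n [S [e [tn hS]]]]].
  by exists 0, (fun=> H); split=> //; split=> // i /ltP.
exists n.+1, (fun i => if i is j.+1 then S j else H); split=> //; split=> // -[_ | i /ltP lt_in].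
  by rewrite e; split=> //; exists x.
by apply: hS; apply/ltP.
Qed.

(** As [H / K] is abelian, every subgroup between [K] and [H] is normal in [H]; adjoining the
    elements of [l] one at a time gives cyclic factors. *)
Lemma polycyclic_abelian_ext H K l : sg H -> sg K -> subset _ K H ->
  (forall a b, H a -> H b -> K [c a, b]) -> subset _ (elts l) H ->
  subset _ H (gen (fun z => elts l z \/ K z)) -> polycyclic_set K -> polycyclic_set H.
Proof.
move=> sH sK sKH cH lH genH pK.
have -> : H = gen (fun z => elts l z \/ K z).
  by apply/funext=> z; apply/propext; split; [apply: genH | apply: gen_min => // y [/lH | /sKH]].
elim: l lH {genH} => [|x l IH] lH.
  suff -> : gen (fun z => elts nil z \/ K z) = K by [].
  apply/funext=> z; apply/propext; split; last by move=> Kz; apply: gen_in; right.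
  by apply: gen_min => // y [].
have {}IH := IH (fun u lu => lH u (or_intror lu)).
set L := gen _ in IH; have sL : sg L := gen_sg _.
have KL u : K u -> L u by move=> Ku; apply: gen_in; right.
have LH : subset _ L H by apply: gen_min => // y [ly | /sKH //]; apply: lH; right.
set L' := gen _; have sL' : sg L' := gen_sg _.
have L'H : subset _ L' H by apply: gen_min => // y [/lH | /sKH].
have LL' : subset _ L L' by apply: gen_mono => y [ly | Ky]; [left; right | right].
apply: (@PolyStep L' L x) => //; first split=> //; first split=> //.
- move=> k u /L'H Hk Lu; rewrite -/(gconj u k) conj_comm; apply: (sgM sL) => //.
  by apply: KL; apply: cH => //; apply: LH.
- by apply: gen_in; left; left.
move=> z; split.
  apply: gen_min; first exact: gen_sg.
  move=> y [[<- | ly] | Ky]; apply: gen_in; [by left | right..].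
    by apply: gen_in; left.
  exact: KL.
by apply: gen_min => // y [-> | /LL' //]; apply: gen_in; left; left.
Qed.

Lemma finite_set_enum (A : gset G) : finite_set _ A -> exists l, forall u, A u <-> List.In u l.
Proof.
move=> [l hl].
suff [l' hl'] : exists l', forall u, List.In u l' <-> List.In u l /\ A u.
  by exists l' => u; split=> [Au | /hl'[]] //; apply/hl'; split=> //; apply: hl.
elim: l {hl} => [|a l [l' IH]]; first by exists nil => u; split=> // -[].
have [Aa | nAa] := pselect (A a).
  exists (a :: l')%SEQ => u; split=> [[<- | /IH[lu Au]] | [[<- | lu] Au]].
  - by split=> //; left.
  - by split=> //; right.
  - by left.
  - by right; apply/IH.
exists l' => u; split=> [/IH[lu Au] | [[<- // | lu] Au]]; first by split=> //; right.
exact/IH.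
Qed.

Lemma derived_finite_polycyclic : finitely_generated G -> soluble _ (setT G) ->
  finite_set _ (derived_subgroup G) -> polycyclic G.
Proof.
move=> [l hl] [n tn] fD; apply: polycyclic_setP.
have sD i := derived_sg i (@sgT G).
have step i l' : subset _ (elts l') (derived _ (setT G) i) ->
    subset _ (derived _ (setT G) i) (gen (fun z => elts l' z \/ derived _ (setT G) i.+1 z)) ->
    polycyclic_set (derived _ (setT G) i.+1) -> polycyclic_set (derived _ (setT G) i).
  move=> s1 s2; apply: polycyclic_abelian_ext s1 s2 => //.
    by apply: commsub_min => // a b; apply: sgR.
  by move=> a b Da Db; apply: commsub_in.
suff main k : k <= n -> polycyclic_set (derived _ (setT G) (n - k)).
  by have := main n (leqnn n); rewrite subnn.
elim: k => [_ | k IH lt_kn]; first by rewrite subn0; apply: PolyTrivial.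
have {IH} := IH (ltnW lt_kn); rewrite -(subnSK lt_kn).
(* The top factor uses the generators of [G]; the lower terms lie in the finite [G'] and are
   generated by their own elements. *)
case: (n - k.+1)%N => [|i] pD.
  apply: (step 0 l) => // z _; apply: gen_mono (hl z) => y; by left.
have [|s hs] := finite_set_enum (A := derived _ (setT G) i.+1).
  have [s hs] := fD; exists s => u Du; apply: hs.
  apply: commsub_mono Du => //; exact: derived_sub.
apply: (step i.+1 s) => // u; first by move/hs.
by move=> Du; apply: gen_in; left; apply/hs.
Qed.

End Polycyclic.

(** * Maximal subgroups supplementing the derived subgroup *)

Section Maximal.
Variables (G : Group) (M : gset G).
Hypothesis maxM : maximal_subgroup _ M.
Hypothesis prodM : product_with_derived_is_G _ M.
Local Open Scope grp_scope.

Let sM : sg M. Proof. by case: maxM. Qed.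

Lemma maximal_adjoin g : ~ M g -> forall z, gen (fun y => y = g \/ M y) z.
Proof.
move=> nMg z; case: maxM => _ [_ mx].
have [|e|e] := mx _ (gen_sg (fun y => y = g \/ M y)).
- by move=> u Mu; apply: gen_in; right.
- by case: nMg; apply/e; apply: gen_in; left.
exact/e.
Qed.

(** If [M] were normal, [G / M] would be cyclic, generated by any [g] outside [M]; then [G'] would
    lie in [M], and [M = M G' = G]. *)
Lemma maximal_not_normal : ~ normalised M (setT G).
Proof.
move=> nM; have [_ [[g nMg] _]] := maxM.
have T := maximal_adjoin nMg.
have Mc u h : M u -> M [c u, h].
  by move=> Mu; rewrite comm_conj; apply: (sgM sM); [apply: (sgV sM) | apply: nM].
have Mcr u h : M h -> M [c u, h].
  by move=> Mh; rewrite -commV; apply: (sgV sM); apply: Mc.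
have cg h : M [c g, h].
  apply: (comm_gen_r sM _ _ (T h)); first by move=> u k _; apply: nM.
  by move=> a [-> | Ma]; [rewrite commgg; apply: sg1 | apply: Mcr].
have cM u h : M [c u, h].
  have [] // := T u _ (comm_subgroup_l h sM (@sgT G) nM).
  by move=> a [-> | Ma]; split=> //; apply: Mc.
have [m [d [Mm [Dd e]]]] := prodM g; apply: nMg; rewrite e; apply: (sgM sM) => //.
by move: d Dd {e}; apply: commsub_min.
Qed.

Lemma maximal_nilpotent : meta_nil_hamiltonian G -> nilpotent _ M.
Proof.
move=> mnh; apply: contrapT => nn; apply: maximal_not_normal.
by have [_] := (normalP _).1 (mnh M sM nn).
Qed.

(** A central [z] outside [M] would give [G = <z, M>], which normalises [M]. *)
Lemma center_sub_maximal : subset _ (center G) M.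
Proof.
move=> z Zz; apply: contrapT => nMz; apply: maximal_not_normal.
have T := maximal_adjoin nMz.
move=> u h _ Mu; apply: (normalised_gen sM _ (T h) Mu) => v a [-> | Ma] Mv.
  have [sZ _] := center_normal G.
  have cz w : center G w -> v ^ w = v by move=> Zw; apply/conj_eq_comm; rewrite Zw.
  by split; rewrite cz //; apply: (sgV sZ).
by split; apply: (sgJ sM) => //; apply: (sgV sM).
Qed.

End Maximal.

Fixpoint sublists T (l : list T) : list (list T) :=
  if l is (a :: l')%SEQ then List.app (sublists l') (List.map (cons a) (sublists l'))
  else (nil :: nil)%SEQ.

Lemma sublists_filter T (l : list T) (P : T -> Prop) :
  exists2 s, List.In s (sublists l) & forall t, List.In t s <-> List.In t l /\ P t.
Proof.
elim: l => [|a l [s ls hs]]; first by exists nil; [left | move=> t; split=> // -[]].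
have [Pa | nPa] := pselect (P a).
  exists (a :: s)%SEQ; first by apply/List.in_app_iff; right; apply: List.in_map.
  move=> t; split=> [[<- | /hs[lt Pt]] | [[<- | lt] Pt]].
  - by split=> //; left.
  - by split=> //; right.
  - by left.
  - by right; apply/hs.
exists s; first by apply/List.in_app_iff; left.
move=> t; split=> [/hs[lt Pt] | [[<- // | lt] Pt]]; first by split=> //; right.
exact/hs.
Qed.

(** Each such [M] contains the centre, so it is a union of cosets of the centre and is determined by
    the representatives in it. *)
Lemma finitely_many_maximal (G : Group) : finite_index _ (center G) (setT G) ->
  exists L : list (gset G), forall M, maximal_subgroup _ M ->
    product_with_derived_is_G _ M -> exists N, List.In N L /\ set_eq _ M N.
Proof.
move=> [l hl].
pose cosets (s : list G) : gset G := fun g => exists t, List.In t s /\ center G (t^-1 * g)%grp.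
exists (List.map cosets (sublists l)) => M maxM prodM.
have ZM := center_sub_maximal maxM prodM; have [sM _] := maxM.
have [s ls hs] := sublists_filter l M.
exists (cosets s); split; first exact: List.in_map.
move=> g; split=> [Mg | [t [/hs[_ Mt] Zt]]]; last first.
  by rewrite -(gmulK t g); apply: (sgM sM) => //; apply: ZM.
have [t [lt Zt]] := hl g I; exists t; split=> //; apply/hs; split=> //.
have -> : t = (g * (t^-1 * g)^-1)%grp by geq.
by apply: (sgM sM) => //; apply: (sgV sM); apply: ZM.
Qed.

Lemma mnh_derived_finite (G : Group) : finitely_generated G -> ~ nilpotent G (setT G) ->
  meta_nil_hamiltonian G -> soluble _ (setT G) -> finite_set _ (derived_subgroup G).
Proof.
move=> fg nn mnh [d td].
have [[g [x hne]] | allE] := pselect (exists g x : G, forall n, eng g x n <> (1)%grp).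
  have [x0] := nonengel_finite mnh td hne; exact: finite_nonengel_derived_finite.
case: nn; have [l hl] := fg.
have lnG : locally_nilpotent (setT G).
  apply: soluble_engel_locally_nilpotent => [|x g _]; first by exists d.
  apply: contrapT => no; apply: allE; exists g, x => n en; apply: no; by exists n.
by apply: nilpotentS (lnG l _) => // x _; apply: hl.
Qed.

From Stdlib Require Import List.

Theorem mainTheorem5 (G : Group) :
  finitely_generated G ->
  ~ nilpotent G (setT G) ->
  meta_nil_hamiltonian G ->
  (exists H : gset G, is_subgroup G H /\ torsion_free G H /\ soluble G H /\
                      finite_index G H (setT G)) ->
  (* (i) *)
  (finite_set G (derived_subgroup G) /\ soluble G (setT G)) /\
  (* (ii) *)
  finite_index G (center G) (setT G) /\
  (* (iii) *)
  (polycyclic G /\ nilpotent G (fitting G) /\ finite_index G (fitting G) (setT G)) /\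
  (* (iv) *)
  ((exists L : list (gset G), forall M, maximal_subgroup G M ->
       product_with_derived_is_G G M -> exists N, In N L /\ set_eq G M N) /\
   (forall M, maximal_subgroup G M -> product_with_derived_is_G G M -> nilpotent G M)).
Proof.
move=> fg nn mnh [H [sH [_ [solH fiH]]]].
have solG := virtually_soluble_mnh mnh sH solH fiH.
have finD := mnh_derived_finite fg nn mnh solG.
have fiZ := center_finite_index fg finD.
split=> //; split=> //; split.
  by split; [apply: derived_finite_polycyclic | apply: fitting_props].
split; first exact: finitely_many_maximal.
by move=> M maxM prodM; apply: maximal_nilpotent.
Qed.
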